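(* Let $M$ be a non-Einstein and non-conformally flat hypersurface in a semi-Riemannian space of constant curvature $N_{s}^{n+1}(c)$, $n\geq 4$, with second fundamental tensor $H$. Let $\widetilde{\kappa}$ be the scalar curvature of $N_s^{n+1}(c)$, and let ${\mathcal U}_{H}\subset M$ be the set of all points at which $H^{2}$ is not a linear combination of $g$ and $H$. If on ${\mathcal U}_{H}$ $$C\cdot C=L_{C}\, Q(g,C)\qquad\text{and}\qquad H^{3}=\mathrm{tr}(H)\, H^{2}+\psi\, H+\rho\, g,$$ where $L_{C}$, $\psi$ and $\rho$ are some functions on ${\mathcal U}_{H}$, then on ${\mathcal U}_{H}$ $$\left(\frac{\kappa+2\varepsilon\psi}{n-1}-\frac{\widetilde{\kappa}}{n+1}-L_{C}\right)C=\frac{n-3}{(n-2)^{2}(n-1)}\, E,$$ where $$E=g\wedge S^{2}+\frac{n-2}{2}\, S\wedge S-\kappa\, g\wedge S+\frac{\kappa^{2}-\mathrm{tr}_{g}(S^{2})}{2(n-1)}\, g\wedge g.$$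
   Context: Manifolds are connected, paracompact, of class $C^\infty$; metrics are nondegenerate of arbitrary signature. $N_{s}^{n+1}(c)$ is a semi-Riemannian space of constant curvature $c=\frac{\widetilde{\kappa}}{n(n+1)}$ with signature $(s,n+1-s)$ and scalar curvature $\widetilde{\kappa}$. $M$, $\dim M=n$, is a connected hypersurface isometrically immersed in $N_s^{n+1}(c)$; $g,R,S,\kappa,C$ denote its (semi-Riemannian) metric tensor, Riemann-Christoffel curvature tensor, Ricci tensor, scalar curvature and Weyl conformal curvature tensor, and $H$ its second fundamental tensor, so that the Gauss equation reads $R-\frac{\widetilde{\kappa}}{2n(n+1)}\, g\wedge g=\frac{\varepsilon}{2}\, H\wedge H$ with $\varepsilon=\pm1$. Here $\mathrm{tr}(H)$ is the trace with respect to $g$; with $g({\mathcal H}X,Y)=H(X,Y)$, $H^{2}(X,Y)=H({\mathcal H}X,Y)$ and $H^{3}(X,Y)=H^{2}({\mathcal H}X,Y)$. Conventions: ${\mathcal R}(X,Y)Z=\nabla_X\nabla_YZ-\nabla_Y\nabla_XZ-\nabla_{[X,Y]}Z$, $R(X_1,X_2,X_3,X_4)=g({\mathcal R}(X_1,X_2)X_3,X_4)$, $S(X,Y)=\mathrm{tr}\{Z\mapsto{\mathcal R}(Z,X)Y\}$, $g({\mathcal S}X,Y)=S(X,Y)$, $\kappa=\mathrm{tr}\,{\mathcal S}$, $S^{2}(X,Y)=S({\mathcal S}X,Y)$. The Kulkarni-Nomizu product of symmetric $(0,2)$-tensors $A,B$ is $$(A\wedge B)(X_1,X_2,X_3,X_4)=A(X_1,X_4)B(X_2,X_3)+A(X_2,X_3)B(X_1,X_4)-A(X_1,X_3)B(X_2,X_4)-A(X_2,X_4)B(X_1,X_3),$$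 and $C=R-\frac{1}{n-2}\, g\wedge S+\frac{\kappa}{2(n-2)(n-1)}\, g\wedge g$. For a $(0,4)$-tensor $B(X_1,X_2,X_3,X_4)=g({\mathcal B}(X_1,X_2)X_3,X_4)$ with each ${\mathcal B}(X,Y)$ a skew-symmetric endomorphism, and a $(0,k)$-tensor $T$, $k\ge1$, $$(B\cdot T)(X_1,\ldots,X_k,X,Y)=-T({\mathcal B}(X,Y)X_1,X_2,\ldots,X_k)-\cdots-T(X_1,\ldots,X_{k-1},{\mathcal B}(X,Y)X_k).$$ For a symmetric $(0,2)$-tensor $A$, put $(X\wedge_AY)Z=A(Y,Z)X-A(X,Z)Y$ and $$Q(A,T)(X_1,\ldots,X_k,X,Y)=-T((X\wedge_AY)X_1,X_2,\ldots,X_k)-\cdots-T(X_1,\ldots,X_{k-1},(X\wedge_AY)X_k).$$ *)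

(* Defs.v *)
From HB Require Import structures.
From mathcomp Require Import all_boot all_order all_algebra.
From mathcomp Require Import all_classical all_reals all_analysis.

Set Implicit Arguments.
Unset Strict Implicit.
Unset Printing Implicit Defensive.

Import Order.TTheory GRing.Theory Num.Theory.
Import numFieldNormedType.Exports.

Local Open Scope classical_set_scope.
Local Open Scope ring_scope.

(** * Tensors on one tangent space

    A tangent space of dimension [n] is ['rV[R]_n].  A (0,2)-tensor is its
    matrix of components; [g] always stands for the matrix of the scalar product,
    symmetric and invertible.  A linear operator is a matrix acting on the right
    of row vectors. *)

Section PointwiseAlgebra.
Variables (R : realType) (n : nat).
Local Notation V := 'rV[R]_n.
Local Notation tensor4 := (V -> V -> V -> V -> R).

Definition bil (A : 'M[R]_n) (X Y : V) : R := (X *m A *m Y^T) 0 0.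

Definition basis_vec (i : 'I_n) : V := delta_mx 0 i.

(* the operator [X |-> X *m raise g A], characterized by
   [bil g (X *m raise g A) Y = bil A X Y] *)
Definition raise (g A : 'M[R]_n) : 'M[R]_n := A *m invmx g.

Definition tr2 (g A : 'M[R]_n) : R := \tr (raise g A).

(* [A^2 (X, Y) = A (X *m raise g A, Y)], and [A^3] is obtained in the same way
   from [A^2] *)
Definition square2 (g A : 'M[R]_n) : 'M[R]_n := raise g A *m A.
Definition cube2 (g A : 'M[R]_n) : 'M[R]_n := raise g A *m square2 g A.

Definition KN (A B : 'M[R]_n) : tensor4 := fun X1 X2 X3 X4 =>
  bil A X1 X4 * bil B X2 X3 + bil A X2 X3 * bil B X1 X4
  - bil A X1 X3 * bil B X2 X4 - bil A X2 X4 * bil B X1 X3.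

(* the endomorphism of [B], characterized by
   [bil g (endo g B X Y Z) W = B X Y Z W] *)
Definition endo (g : 'M[R]_n) (B : tensor4) (X Y Z : V) : V :=
  (\row_j B X Y Z (basis_vec j)) *m invmx g.

Definition wedge_endo (A : 'M[R]_n) (X Y Z : V) : V :=
  bil A Y Z *: X - bil A X Z *: Y.

Definition derivation_action (D : V -> V) (T : tensor4) : tensor4 :=
  fun X1 X2 X3 X4 =>
  - T (D X1) X2 X3 X4 - T X1 (D X2) X3 X4
  - T X1 X2 (D X3) X4 - T X1 X2 X3 (D X4).

(* [B . T] and [Q(A, T)]; only the case of a (0,4)-tensor [T] is needed *)
Definition dotT (g : 'M[R]_n) (B T : tensor4) (X1 X2 X3 X4 X Y : V) : R :=
  derivation_action (endo g B X Y) T X1 X2 X3 X4.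

Definition QT (A : 'M[R]_n) (T : tensor4) (X1 X2 X3 X4 X Y : V) : R :=
  derivation_action (wedge_endo A X Y) T X1 X2 X3 X4.

Definition weyl_of (g S : 'M[R]_n) (kappa : R) (Riem : tensor4) : tensor4 :=
  fun X1 X2 X3 X4 =>
  Riem X1 X2 X3 X4
  - (n%:R - 2)^-1 * KN g S X1 X2 X3 X4
  + kappa / (2 * (n%:R - 2) * (n%:R - 1)) * KN g g X1 X2 X3 X4.

Definition E_of (g S : 'M[R]_n) (kappa : R) : tensor4 := fun X1 X2 X3 X4 =>
  KN g (square2 g S) X1 X2 X3 X4
  + (n%:R - 2) / 2 * KN S S X1 X2 X3 X4
  - kappa * KN g S X1 X2 X3 X4
  + (kappa ^+ 2 - tr2 g (square2 g S)) / (2 * (n%:R - 1))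
      * KN g g X1 X2 X3 X4.

(* [s] negative and [n - s] positive squares *)
Definition has_signature (s : nat) (g : 'M[R]_n) : Prop :=
  (s <= n)%N /\
  exists2 P : 'M[R]_n, P \in unitmx &
    P *m g *m P^T = diag_mx (\row_(i < n) if (i < s)%N then -1 else 1).

End PointwiseAlgebra.

(** * Calculus in one coordinate domain *)

Section LocalCalculus.
Variable R : realType.

(* C^k regularity, used on open sets [A] only *)
Fixpoint is_Ck (V W : normedModType R) (k : nat) (A : set V) (f : V -> W) :
    Prop :=
  match k with
  | 0 => forall x, A x -> {for x, continuous f}
  | k'.+1 => (forall x, A x -> differentiable f x) /\
             forall v : V, is_Ck k' A (fun x => 'D_v f x)
  end.

Definition smooth_on (V W : normedModType R) (A : set V) (f : V -> W) : Prop :=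
  forall k, is_Ck k A f.

Variable n : nat.
Local Notation V := 'rV[R]_n.

(* In this section [G y] is the matrix of the metric at the point with
   coordinates [y]. *)
Variable G : V -> 'M[R]_n.

(* Christoffel symbols as a bilinear map: [christoffel x u v] is the Levi-Civita
   derivative at [x] of the constant field [v] in the direction [u], given by
   the Koszul formula for constant (hence commuting) fields. *)
Definition christoffel (x u v : V) : V :=
  (\row_k (2^-1 * ('D_u (fun y => bil (G y) v (basis_vec R k)) x
                   + 'D_v (fun y => bil (G y) u (basis_vec R k)) x
                   - 'D_(basis_vec R k) (fun y => bil (G y) u v) x)))
  *m invmx (G x).

Definition nabla (X Y : V -> V) : V -> V :=
  fun x => 'D_(X x) Y x + christoffel x (X x) (Y x).

Definition lie_bracket (X Y : V -> V) : V -> V :=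
  fun x => 'D_(X x) Y x - 'D_(Y x) X x.

Definition curvature (X Y Z : V -> V) : V -> V :=
  fun x => nabla X (nabla Y Z) x - nabla Y (nabla X Z) x
           - nabla (lie_bracket X Y) Z x.

(* By tensoriality the value on tangent vectors [u v w] at [x] may be computed
   on their constant extensions. *)
Definition curvature_at (x u v w : V) : V :=
  curvature (cst u) (cst v) (cst w) x.

End LocalCalculus.

(** * Manifolds *)

Definition paracompact (T : topologicalType) : Prop :=
  forall C : set (set T),
    (forall A, C A -> open A) -> \bigcup_(A in C) A = [set: T] ->
  exists D : set (set T),
    [/\ forall B, D B -> open B,
        \bigcup_(B in D) B = [set: T],
        forall B, D B -> exists2 A, C A & B `<=` A
      & forall x : T, exists2 W, nbhs x W &
          finite_set [set B | D B /\ B `&` W !=set0]].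

Record chart (R : realType) (n : nat) (T : topologicalType) := Chart {
  chart_dom : set T;
  chart_map :> T -> 'rV[R]_n;
  chart_inv : 'rV[R]_n -> T;
  chart_dom_open : open chart_dom;
  chart_cod_open : open (chart_map @` chart_dom);
  chart_mapK : forall p, chart_dom p -> chart_inv (chart_map p) = p;
  chart_map_continuous :
    forall p, chart_dom p -> {for p, continuous chart_map};
  chart_inv_continuous :
    forall x, (chart_map @` chart_dom) x -> {for x, continuous chart_inv}
}.

Definition chart_cod (R : realType) (n : nat) (T : topologicalType)
  (phi : chart R n T) : set 'rV[R]_n := phi @` chart_dom phi.

(* The charts [chart_at p] form the atlas.  The preferred chart [chart_at p]
   around [p] also identifies the tangent space at [p] with ['rV[R]_n]. *)
Record manifold (R : realType) (n : nat) := Manifold {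
  manifold_space :> topologicalType;
  chart_at : manifold_space -> chart R n manifold_space;
  chart_at_mem : forall p, chart_dom (chart_at p) p;
  transition_smooth : forall p q,
    smooth_on (chart_at p @` (chart_dom (chart_at p)
                              `&` chart_dom (chart_at q)))
              (chart_at q \o chart_inv (chart_at p));
  manifold_hausdorff : hausdorff_space manifold_space;
  manifold_connected : connected [set: manifold_space];
  manifold_paracompact : paracompact manifold_space
}.

Section Metrics.
Variables (R : realType) (n : nat) (M : manifold R n).

(* Components, in the chart [chart_at p] and at the point with coordinates [x],
   of a field [g] of (0,2)-tensors.  As [g q] is given by its components in
   [chart_at q], tangent vectors are first transported by the differential of
   the change of coordinates. *)
Definition local_gram (g : M -> 'M[R]_n) (p : M) (x : 'rV[R]_n) : 'M[R]_n :=
  let q := chart_inv (chart_at p) x in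
  let to_q v := 'D_v (chart_at q \o chart_inv (chart_at p)) x in
  \matrix_(i, j) bil (g q) (to_q (basis_vec R i)) (to_q (basis_vec R j)).

Record metric := Metric {
  gram :> M -> 'M[R]_n;
  gram_sym : forall p, (gram p)^T = gram p;
  gram_nondegenerate : forall p, gram p \in unitmx;
  gram_smooth : forall p, smooth_on (chart_cod (chart_at p)) (local_gram gram p)
}.

Variable g : metric.

Definition riemann_op (p : M) (X Y Z : 'rV[R]_n) : 'rV[R]_n :=
  curvature_at (local_gram g p) (chart_at p p) X Y Z.

Definition riemann (p : M) (X1 X2 X3 X4 : 'rV[R]_n) : R :=
  bil (g p) (riemann_op p X1 X2 X3) X4.

Definition ricci (p : M) : 'M[R]_n :=
  \matrix_(i, j)
    \tr (lin1_mx (fun Z => riemann_op p Z (basis_vec R i) (basis_vec R j))).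

Definition scalar_curvature (p : M) : R := tr2 (g p) (ricci p).

Definition weyl (p : M) : 'rV[R]_n -> 'rV[R]_n -> 'rV[R]_n -> 'rV[R]_n -> R :=
  weyl_of (g p) (ricci p) (scalar_curvature p) (riemann p).

Definition tensor_E (p : M) :
    'rV[R]_n -> 'rV[R]_n -> 'rV[R]_n -> 'rV[R]_n -> R :=
  E_of (g p) (ricci p) (scalar_curvature p).

Definition einstein : Prop :=
  forall p, ricci p = (scalar_curvature p / n%:R) *: g p.

(* every point has a neighbourhood on which some conformal metric [lam g],
   [lam > 0], is flat *)
Definition conformally_flat : Prop :=
  forall p, exists (U : set 'rV[R]_n) (lam : 'rV[R]_n -> R),
    [/\ open U, U (chart_at p p), U `<=` chart_cod (chart_at p),
        smooth_on U (lam : 'rV[R]_n -> R^o)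
      & forall x, U x -> 0 < lam x /\
          forall u v w,
            curvature_at (fun y => lam y *: local_gram g p y) x u v w = 0].

Definition constant_curvature_space (s : nat) (c : R) : Prop :=
  forall p, has_signature s (g p) /\
    forall X1 X2 X3 X4,
      riemann p X1 X2 X3 X4 = c / 2 * KN (g p) (g p) X1 X2 X3 X4.

End Metrics.

(** * Hypersurfaces *)

Section Hypersurfaces.
Variables (R : realType) (n m : nat) (M : manifold R n) (N : manifold R m).
Variables (g : metric M) (gN : metric N) (F : M -> N).

Definition smooth_map : Prop :=
  continuous F /\
  forall (p : M) (q : N),
    smooth_on (chart_at p @` (chart_dom (chart_at p)
                              `&` F @^-1` chart_dom (chart_at q)))
              (chart_at q \o F \o chart_inv (chart_at p)).

Definition local_map (p : M) : 'rV[R]_n -> 'rV[R]_m :=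
  chart_at (F p) \o F \o chart_inv (chart_at p).

Definition dmap (p : M) (v : 'rV[R]_n) : 'rV[R]_m :=
  'D_v (local_map p) (chart_at p p).

Definition isometric_immersion : Prop :=
  [/\ smooth_map, forall p, injective (dmap p)
    & forall p u v, bil (gN (F p)) (dmap p u) (dmap p v) = bil (g p) u v].

Definition unit_normal (eps : R) (xi : M -> 'rV[R]_m) : Prop :=
  forall p, bil (gN (F p)) (xi p) (xi p) = eps /\
            forall u, bil (gN (F p)) (dmap p u) (xi p) = 0.

(* ambient covariant derivative, in the direction [u] at [p], of the field along
   [F] that is the image of the coordinate-constant field [v] *)
Definition ambient_derivative (p : M) (u v : 'rV[R]_n) : 'rV[R]_m :=
  let x := chart_at p p in
  'D_u (fun y => 'D_v (local_map p) y) x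
  + christoffel (local_gram gN (F p)) (local_map p x) (dmap p u) (dmap p v).

(* [H(X, Y)] is the scalar product of the ambient derivative of [Y] along [X]
   with [xi]; equivalently, the normal part of that derivative is
   [eps * H(X, Y) * xi].  The value at [p] depends on [xi] only through [xi p]. *)
Definition second_fundamental (xi : M -> 'rV[R]_m) (p : M) : 'M[R]_n :=
  \matrix_(i, j)
    bil (gN (F p)) (ambient_derivative p (basis_vec R i) (basis_vec R j)) (xi p).

End Hypersurfaces.

(* the points at which [H^2] is not a linear combination of [g] and [H] *)
Definition U_H (R : realType) (n : nat) (M : manifold R n) (g : metric M)
    (H : M -> 'M[R]_n) : set M :=
  [set p | ~ exists a b : R, square2 (g p) (H p) = a *: g p + b *: H p].

(* Main.v *)
(* Write [H] also for the shape operator, [t = tr H], and [W] for the Weyl part of [1/2 H ^ H].  By the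
   Gauss equation [C = eps W], and [E] is [n - 2] times the Weyl part of [1/2 S ^ S].  With
   [H^3 = t H^2 + psi H + rho g] one finds
     [W . W = alpha Q(g, W) + beta (H ^ Q(H, H^2) - rho / (n - 2) g ^ Q(g, H))]
   for explicit scalars [alpha] and [beta].  Contract the first argument with [X] in
   [C . C = L_C Q(g, C)]: then [Q(g, W)] becomes [(n - 1) W] and the remaining term becomes a
   combination of [W] and of the Weyl part of [1/2 S ^ S], which is the theorem.

   The Gauss equation is obtained in coordinates without differentiating the normal [xi], which is
   only given pointwise: [<R(u, v) w, z>] is the antisymmetrization in [u, v] of
   [D_u <Gamma(v, w), z> - <Gamma(u, z), Gamma(v, w)>], for the hypersurface and for the ambient
   space alike, and the ambient derivative of [D_w f] along [v] has the tangential components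
   [<Gamma(v, w), z>]. *)
Require Import Defs.
From HB Require Import structures.
From mathcomp Require Import all_boot all_order all_algebra.
From mathcomp Require Import all_classical all_reals all_analysis.
From mathcomp Require Import ring lra zify.

Set Implicit Arguments.
Unset Strict Implicit.
Unset Printing Implicit Defensive.

Import Order.TTheory GRing.Theory Num.Theory.
Import numFieldNormedType.Exports.

Local Open Scope classical_set_scope.
Local Open Scope ring_scope.

(** * Curvature tensors on one tangent space *)

Section Bilinear.
Variables (R : realType) (n : nat).
Implicit Types (A B : 'M[R]_n) (X Y Z : 'rV[R]_n) (a : R).

Lemma bilDl A X Y Z : bil A (X + Y) Z = bil A X Z + bil A Y Z.
Proof. by rewrite /bil !mulmxDl mxE. Qed.

Lemma bilDr A X Y Z : bil A Z (X + Y) = bil A Z X + bil A Z Y.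
Proof. by rewrite /bil linearD /= mulmxDr mxE. Qed.

Lemma bilZl A a X Y : bil A (a *: X) Y = a * bil A X Y.
Proof. by rewrite /bil -!scalemxAl mxE. Qed.

Lemma bilZr A a X Y : bil A X (a *: Y) = a * bil A X Y.
Proof. by rewrite /bil linearZ /= -!scalemxAr mxE. Qed.

Lemma bilNl A X Y : bil A (- X) Y = - bil A X Y.
Proof. by rewrite -scaleN1r bilZl mulN1r. Qed.

Lemma bilNr A X Y : bil A X (- Y) = - bil A X Y.
Proof. by rewrite -scaleN1r bilZr mulN1r. Qed.

Lemma bil0l A X : bil A 0 X = 0.
Proof. by rewrite -(scale0r 0) bilZl mul0r. Qed.

Lemma bil0r A X : bil A X 0 = 0.
Proof. by rewrite -(scale0r 0) bilZr mul0r. Qed.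

Lemma bilMD A B X Y : bil (A + B) X Y = bil A X Y + bil B X Y.
Proof. by rewrite /bil mulmxDr mulmxDl mxE. Qed.

Lemma bilMZ a A X Y : bil (a *: A) X Y = a * bil A X Y.
Proof. by rewrite /bil -scalemxAr -scalemxAl mxE. Qed.

Lemma bilMN A X Y : bil (- A) X Y = - bil A X Y.
Proof. by rewrite -scaleN1r bilMZ mulN1r. Qed.

Definition bilE := (bilDl, bilDr, bilNl, bilNr, bilZl, bilZr).

Lemma bilC A X Y : A^T = A -> bil A X Y = bil A Y X.
Proof.
move=> sA; rewrite /bil -[in RHS]sA.
have -> : Y *m A^T *m X^T = (X *m A *m Y^T)^T by rewrite !trmx_mul trmxK mulmxA.
by rewrite [RHS]mxE.
Qed.

Lemma bil_mulmx A B X Y : bil A (X *m B) Y = bil (B *m A) X Y.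
Proof. by rewrite /bil !mulmxA. Qed.

Lemma bil_sum A X Y : bil A X Y = \sum_i \sum_j X 0 i * A i j * Y 0 j.
Proof.
rewrite /bil mxE exchange_big; apply: eq_bigr => j _ /=.
by rewrite mxE big_distrl; apply: eq_bigr => i _; rewrite mxE.
Qed.

Lemma bil_basisr A X j : bil A X (basis_vec R j) = (X *m A) 0 j.
Proof.
rewrite /bil mxE (bigD1 j) //= big1 => [|k kj]; rewrite !mxE ?eqxx ?mulr1 ?addr0 //.
by rewrite (negbTE kj) andbF mulr0.
Qed.

Lemma bil_basis A i j : bil A (basis_vec R i) (basis_vec R j) = A i j.
Proof. by rewrite bil_basisr -rowE mxE. Qed.

Lemma bil_ndg A X : A \in unitmx -> (forall Y, bil A X Y = 0) -> X = 0.
Proof.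
move=> uA X0; rewrite -[X](mulmxK uA); suff -> : X *m A = 0 by rewrite mul0mx.
by apply/rowP => j; rewrite -bil_basisr X0 mxE.
Qed.

Lemma bil_inj A X Y : A \in unitmx -> (forall Z, bil A X Z = bil A Y Z) -> X = Y.
Proof.
move=> uA XY; apply/subr0_eq/(bil_ndg uA) => Z.
by rewrite bilDl bilNl XY subrr.
Qed.

End Bilinear.

(** * Raising indices, metric contractions, and curvature-like tensors acting as derivations *)

Section PointwiseTensors.
Variables (R : realType) (n : nat) (g : 'M[R]_n).
Hypotheses (gT : g^T = g) (gU : g \in unitmx).
Implicit Types (A B P : 'M[R]_n) (X Y Z U V : 'rV[R]_n).
Local Notation tensor2 := ('rV[R]_n -> 'rV[R]_n -> R).

Let giT : (invmx g)^T = invmx g.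
Proof. by rewrite trmx_inv gT. Qed.

(** Composition of the associated operators, lowered back to a (0,2)-tensor: [g] is its unit, and
    [comp2 A A] and [comp2 A (comp2 A A)] are [square2 g A] and [cube2 g A] by definition. Every
    power of [H] below is computed in this product. *)
Definition comp2 A B : 'M[R]_n := raise g A *m B.

Lemma comp2gl A : comp2 g A = A.
Proof. by rewrite /comp2 /raise mulmxV // mul1mx. Qed.

Lemma comp2gr A : comp2 A g = A.
Proof. by rewrite /comp2 /raise mulmxKV. Qed.

Lemma comp2A A B P : comp2 A (comp2 B P) = comp2 (comp2 A B) P.
Proof. by rewrite /comp2 /raise !mulmxA. Qed.

Lemma comp2Dl A B P : comp2 (A + B) P = comp2 A P + comp2 B P.
Proof. by rewrite /comp2 /raise !mulmxDl. Qed.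

Lemma comp2Dr A B P : comp2 P (A + B) = comp2 P A + comp2 P B.
Proof. by rewrite /comp2 mulmxDr. Qed.

Lemma comp2Zl a A B : comp2 (a *: A) B = a *: comp2 A B.
Proof. by rewrite /comp2 /raise -!scalemxAl. Qed.

Lemma comp2Zr a A B : comp2 A (a *: B) = a *: comp2 A B.
Proof. by rewrite /comp2 -scalemxAr. Qed.

Lemma tr_comp2 A B : A^T = A -> B^T = B -> (comp2 A B)^T = comp2 B A.
Proof. by move=> sA sB; rewrite /comp2 /raise !trmx_mul sA sB giT mulmxA. Qed.

Lemma tr2D A B : tr2 g (A + B) = tr2 g A + tr2 g B.
Proof. by rewrite /tr2 /raise mulmxDl linearD. Qed.

Lemma tr2Z a A : tr2 g (a *: A) = a * tr2 g A.
Proof. by rewrite /tr2 /raise -scalemxAl linearZ. Qed.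

Lemma tr2g : tr2 g g = n%:R.
Proof. by rewrite /tr2 /raise mulmxV // mxtrace1. Qed.

Lemma bil_raise A B X Y : bil B (X *m raise g A) Y = bil (comp2 A B) X Y.
Proof. by rewrite bil_mulmx. Qed.

Lemma bil_raiser A B X Y :
  A^T = A -> B^T = B -> bil B Y (X *m raise g A) = bil (comp2 A B) X Y.
Proof. by move=> sA sB; rewrite bilC // bil_raise. Qed.

(* the dual basis of [basis_vec R i] with respect to [g] *)
Definition dual_vec (i : 'I_n) : 'rV[R]_n := basis_vec R i *m invmx g.

(** Pairing a basis with its dual basis replaces an orthonormal frame, so no signs depending on the
    signature appear in contractions. *)
Lemma contract_tr A : \sum_i bil A (basis_vec R i) (dual_vec i) = tr2 g A.
Proof.
rewrite /tr2 /mxtrace; apply: eq_bigr => i _.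
by rewrite /bil /dual_vec /basis_vec trmx_mul giT trmx_delta mulmxA -colE -mulmxA -rowE !mxE.
Qed.

Lemma contract_comp A B U V : A^T = A ->
  \sum_i bil A (basis_vec R i) U * bil B (dual_vec i) V = bil (comp2 A B) U V.
Proof.
move=> sA; rewrite /bil /comp2 /raise.
have -> : U *m (A *m invmx g *m B) *m V^T = (U *m A) *m (invmx g *m B *m V^T).
  by rewrite !mulmxA.
rewrite [RHS]mxE; apply: eq_bigr => i _.
rewrite -/(bil A _ _) bilC // bil_basisr; congr (_ * _).
by rewrite /dual_vec /basis_vec -!mulmxA -rowE mxE.
Qed.

(** Turns the operator trace in the definition of the Ricci tensor into a contraction of the first
    and fourth arguments of the curvature tensor. *)
Lemma mxtrace_lin1 (f : 'rV[R]_n -> 'rV[R]_n) :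
  \tr (lin1_mx f) = \sum_i bil g (f (basis_vec R i)) (dual_vec i).
Proof.
apply: eq_bigr => i _; rewrite mxE /bil /dual_vec trmx_mul giT mulmxA mulmxK //.
by rewrite trmx_delta -colE mxE.
Qed.

Lemma contract_KN A B X Y : A^T = A -> B^T = B ->
  \sum_i KN A B (basis_vec R i) X Y (dual_vec i) =
  tr2 g A * bil B X Y + tr2 g B * bil A X Y
  - bil (comp2 A B) Y X - bil (comp2 B A) Y X.
Proof.
move=> sA sB; under eq_bigr => i _.
  rewrite /KN (bilC X (dual_vec i) sA) (bilC X (dual_vec i) sB).
  rewrite [bil A X Y * _]mulrC [bil A (dual_vec i) X * _]mulrC.
  over.
by rewrite !sumrB big_split /= -!mulr_suml !contract_tr !contract_comp.
Qed.

(** Serves both spaces: the hypersurface with [A = H] and [b = eps], and the ambient space with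
    [b = 0]. *)
Lemma ricci_gauss (A : 'M[R]_n) (a b : R) (op : 'rV[R]_n -> 'rV[R]_n -> 'rV[R]_n -> 'rV[R]_n) :
  A^T = A ->
  (forall X Y Z W, bil g (op X Y Z) W = a / 2 * KN g g X Y Z W + b / 2 * KN A A X Y Z W) ->
  \matrix_(i, j) \tr (lin1_mx (fun Z => op Z (basis_vec R i) (basis_vec R j))) =
  b *: (tr2 g A *: A - square2 g A) + ((n%:R - 1) * a) *: g.
Proof.
move=> sA opE; apply/matrixP => i j; rewrite mxE mxtrace_lin1.
under eq_bigr do rewrite opE.
rewrite big_split /= -!mulr_sumr !contract_KN // comp2gl tr2g (_ : comp2 A A = square2 g A) //.
have s2A : (square2 g A)^T = square2 g A by exact: tr_comp2.
by rewrite !(bilC (basis_vec R j)) // !bil_basis !mxE; field.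
Qed.

(** The formula of [KN] for functions instead of matrices: after a derivation has acted, one factor
    is [act2 D A], which does not come as a matrix. *)
Definition KNf (P Q : tensor2) X1 X2 X3 X4 : R :=
  P X1 X4 * Q X2 X3 + P X2 X3 * Q X1 X4 - P X1 X3 * Q X2 X4 - P X2 X4 * Q X1 X3.

Definition act2 (D : 'rV[R]_n -> 'rV[R]_n) A U V : R :=
  - bil A (D U) V - bil A U (D V).

(** The Leibniz rule. It reduces the action on [C] to the actions on [g], [H] and [H^2]. *)
Lemma derivation_KN D A B X1 X2 X3 X4 :
  derivation_action D (KN A B) X1 X2 X3 X4 =
  KNf (act2 D A) (bil B) X1 X2 X3 X4 + KNf (bil A) (act2 D B) X1 X2 X3 X4.
Proof. rewrite /derivation_action /KN /KNf /act2; ring. Qed.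

Lemma endo_KN A B X Y Z : 
  endo g (KN A B) X Y Z =
    bil B Y Z *: (X *m raise g A) + bil A Y Z *: (X *m raise g B)
    - bil A X Z *: (Y *m raise g B) - bil B X Z *: (Y *m raise g A).
Proof.
rewrite /endo /raise !mulmxA !scalemxAl -!mulNmx -!mulmxDl; congr (_ *m _).
rewrite !mulNmx -!scalemxAl.
apply/rowP => j; rewrite 2!mxE /KN !bil_basisr.
move: (X *m A) (X *m B) (Y *m A) (Y *m B) => XA XB YA YB; rewrite !mxE; ring.
Qed.

(* [Q(A, B)], evaluated on [(U, V, X, Y)] *)
Definition Q2 A B X Y U V : R :=
  bil A X U * bil B Y V + bil A X V * bil B Y U
  - bil A Y U * bil B X V - bil A Y V * bil B X U.

(** The product expands into sixteen terms. In each, a basis vector and its dual sit either in one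
    bilinear form, which gives a trace, or in two, which gives a composition. *)
Lemma contract_KN_Q2 P A B Y X2 X3 X4 :
  P^T = P -> A^T = A -> B^T = B ->
  \sum_i KNf (bil P) (Q2 A B (dual_vec i) Y) (basis_vec R i) X2 X3 X4 =
  bil (comp2 P A) X4 X2 * bil B Y X3 + bil (comp2 P A) X4 X3 * bil B Y X2
  - bil A Y X2 * bil (comp2 P B) X4 X3 - bil A Y X3 * bil (comp2 P B) X4 X2
  - bil (comp2 P A) X3 X2 * bil B Y X4 - bil (comp2 P A) X3 X4 * bil B Y X2
  + bil A Y X2 * bil (comp2 P B) X3 X4 + bil A Y X4 * bil (comp2 P B) X3 X2
  + bil P X2 X3 * (tr2 g A * bil B Y X4 + bil (comp2 B A) Y X4
                   - bil (comp2 A B) Y X4 - tr2 g B * bil A Y X4)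
  - bil P X2 X4 * (tr2 g A * bil B Y X3 + bil (comp2 B A) Y X3
                   - bil (comp2 A B) Y X3 - tr2 g B * bil A Y X3).
Proof.
move=> sP sA sB.
under eq_bigr => i _.
  have -> : KNf (bil P) (Q2 A B (dual_vec i) Y) (basis_vec R i) X2 X3 X4 =
  bil B Y X3 * (bil P (basis_vec R i) X4 * bil A (dual_vec i) X2)
  + bil B Y X2 * (bil P (basis_vec R i) X4 * bil A (dual_vec i) X3)
  - bil A Y X2 * (bil P (basis_vec R i) X4 * bil B (dual_vec i) X3)
  - bil A Y X3 * (bil P (basis_vec R i) X4 * bil B (dual_vec i) X2)
  - bil B Y X4 * (bil P (basis_vec R i) X3 * bil A (dual_vec i) X2)
  - bil B Y X2 * (bil P (basis_vec R i) X3 * bil A (dual_vec i) X4)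
  + bil A Y X2 * (bil P (basis_vec R i) X3 * bil B (dual_vec i) X4)
  + bil A Y X4 * (bil P (basis_vec R i) X3 * bil B (dual_vec i) X2)
  + bil P X2 X3 * bil B Y X4 * bil A (basis_vec R i) (dual_vec i)
  + bil P X2 X3 * (bil B (basis_vec R i) Y * bil A (dual_vec i) X4)
  - bil P X2 X3 * (bil A (basis_vec R i) Y * bil B (dual_vec i) X4)
  - bil P X2 X3 * bil A Y X4 * bil B (basis_vec R i) (dual_vec i)
  - bil P X2 X4 * bil B Y X3 * bil A (basis_vec R i) (dual_vec i)
  - bil P X2 X4 * (bil B (basis_vec R i) Y * bil A (dual_vec i) X3)
  + bil P X2 X4 * (bil A (basis_vec R i) Y * bil B (dual_vec i) X3)
  + bil P X2 X4 * bil A Y X3 * bil B (basis_vec R i) (dual_vec i).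
    rewrite /KNf /Q2 (bilC (dual_vec i) (basis_vec R i) sA)
      (bilC (dual_vec i) (basis_vec R i) sB)
      (bilC Y (basis_vec R i) sA) (bilC Y (basis_vec R i) sB).
    ring.
  over.
by rewrite !(big_split, sumrN, sumrB) /= -!mulr_sumr !contract_comp // !contract_tr; ring.
Qed.

Lemma Q2_diag A X Y U V : Q2 A A X Y U V = 0.
Proof. rewrite /Q2; ring. Qed.

Lemma act2_wedge P X Y U V : P^T = P ->
  act2 (wedge_endo g X Y) P U V = Q2 g P X Y U V.
Proof.
move=> sP; rewrite /act2 /wedge_endo !bilE /Q2 (bilC U X sP) (bilC U Y sP); ring.
Qed.

(** By [endo_KN] the endomorphism is a sum of terms such as [bil B Y Z] times the vector [X] raised
    by [A]. Inserting such a term into [P] composes [A] with [P] and leaves [B] alone, and the terms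
    collect into two tensors [Q2]. Since [X] and [Y] always stand first in [Q2], the formula is
    right also for a non-symmetric [comp2 B P]. *)
Lemma act2_KN A B P X Y U V : A^T = A -> B^T = B -> P^T = P ->
  act2 (endo g (KN A B) X Y) P U V =
  Q2 A (comp2 B P) X Y U V + Q2 B (comp2 A P) X Y U V.
Proof.
move=> sA sB sP.
rewrite /act2 !endo_KN !bilE !bil_raise !bil_raiser // /Q2; ring.
Qed.

Lemma Q2_lin A a b c (B1 B2 B3 : 'M[R]_n) X Y U V :
  Q2 A (a *: B1 + b *: B2 + c *: B3) X Y U V =
  a * Q2 A B1 X Y U V + b * Q2 A B2 X Y U V + c * Q2 A B3 X Y U V.
Proof. rewrite /Q2 !(bilMD, bilMZ); ring. Qed.

(** Four summands, because [weyl_hypersurface] writes [C] as a combination of four Kulkarni-Nomizu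
    products. *)
Lemma derivation_lin D (T T1 T2 T3 T4 : 'rV[R]_n -> 'rV[R]_n -> tensor2) a b c d :
  (forall X1 X2 X3 X4, T X1 X2 X3 X4 = a * T1 X1 X2 X3 X4 + b * T2 X1 X2 X3 X4
     + c * T3 X1 X2 X3 X4 + d * T4 X1 X2 X3 X4) ->
  forall X1 X2 X3 X4, derivation_action D T X1 X2 X3 X4 =
     a * derivation_action D T1 X1 X2 X3 X4 + b * derivation_action D T2 X1 X2 X3 X4
     + c * derivation_action D T3 X1 X2 X3 X4 + d * derivation_action D T4 X1 X2 X3 X4.
Proof. move=> TE *; rewrite /derivation_action !TE; ring. Qed.

Lemma act2_endo_lin (T T1 T2 T3 T4 : 'rV[R]_n -> 'rV[R]_n -> tensor2) a b c d P X Y U V :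
  (forall X1 X2 X3 X4, T X1 X2 X3 X4 = a * T1 X1 X2 X3 X4 + b * T2 X1 X2 X3 X4
     + c * T3 X1 X2 X3 X4 + d * T4 X1 X2 X3 X4) ->
  act2 (endo g T X Y) P U V =
     a * act2 (endo g T1 X Y) P U V + b * act2 (endo g T2 X Y) P U V
     + c * act2 (endo g T3 X Y) P U V + d * act2 (endo g T4 X Y) P U V.
Proof.
move=> TE; have endoE Z : endo g T X Y Z = a *: endo g T1 X Y Z
    + b *: endo g T2 X Y Z + c *: endo g T3 X Y Z + d *: endo g T4 X Y Z.
  rewrite /endo !scalemxAl -!mulmxDl; congr (_ *m _).
  by apply/rowP => j; rewrite !mxE TE.
rewrite /act2 !endoE !bilE; ring.
Qed.

(** * The pointwise identity for a hypersurface satisfying the cubic relation on [H] *)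

Section Hypersurface.
Variables (H : 'M[R]_n) (eps c psi rho : R).
Hypotheses (HT : H^T = H) (eps2 : eps ^+ 2 = 1) (n4 : (4 <= n)%N).
Local Notation H2 := (square2 g H).
Local Notation t := (tr2 g H).
Local Notation s2 := (tr2 g H2).
Local Notation N := (n%:R : R).
Hypothesis H3E : cube2 g H = t *: H2 + psi *: H + rho *: g.
Variables (S : 'M[R]_n) (kappa LC : R) (Riem : 'rV[R]_n -> 'rV[R]_n -> tensor2).
Hypothesis RiemE : forall X1 X2 X3 X4, Riem X1 X2 X3 X4 =
  c / 2 * KN g g X1 X2 X3 X4 + eps / 2 * KN H H X1 X2 X3 X4.
Hypothesis SE : S = eps *: (t *: H - H2) + ((N - 1) * c) *: g.
Hypothesis kappaE : kappa = tr2 g S.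

Let N1 : N - 1 != 0.
Proof. by rewrite subr_eq0 (eqr_nat _ _ 1); lia. Qed.

Let N2 : N - 2 != 0.
Proof. by rewrite subr_eq0 eqr_nat; lia. Qed.

Let eps_cases : eps = 1 \/ eps = -1.
Proof. by have /eqP := eps2; rewrite sqrf_eq1 => /orP[] /eqP; [left | right]. Qed.

Let H2T : H2^T = H2.
Proof. exact: tr_comp2. Qed.

Let HHE : comp2 H H = H2. Proof. by []. Qed.

Let HH2E : comp2 H H2 = t *: H2 + psi *: H + rho *: g.
Proof. exact: H3E. Qed.

Let H2HE : comp2 H2 H = t *: H2 + psi *: H + rho *: g.
Proof. by rewrite -HH2E /comp2 /square2 /raise !mulmxA. Qed.

(** The fourth power is the highest one that occurs: in the action of the [g ^ H^2] part of [C] on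
    [H^2], and in [S^2]. *)
Let H4E : comp2 H2 H2 = (t ^+ 2 + psi) *: H2 + (t * psi + rho) *: H + (t * rho) *: g.
Proof.
have -> : comp2 H2 H2 = comp2 H (comp2 H H2) by rewrite -HHE !comp2A.
rewrite HH2E !comp2Dr !comp2Zr HH2E HHE comp2gr.
by apply/matrixP => i j; rewrite !mxE; ring.
Qed.

Let kappaE' : kappa = eps * (t ^+ 2 - s2) + N * (N - 1) * c.
Proof.
rewrite kappaE SE tr2D !tr2Z tr2g tr2D tr2Z -scaleN1r tr2Z; ring.
Qed.

(** [alpha] and [beta] are the scalars in the formula for [W . W], and [mu] is the coefficient of
    [g ^ g] in [W]; thus [alpha = psi / (n - 2) + 2 mu]. *)
Let alpha := psi / (N - 2) + (t ^+ 2 - s2) / ((N - 1) * (N - 2)).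
Let beta := (N - 3) / (N - 2).
Let mu := (t ^+ 2 - s2) / (2 * (N - 1) * (N - 2)).

Local Notation a1 := (eps / 2).
Local Notation a2 := (- (eps * t / (N - 2))).
Local Notation a3 := (eps / (N - 2)).
Local Notation a4 := (eps * mu).

Let C := weyl_of g S kappa Riem.

(** The constant [c] drops out: its contributions to the coefficient of [g ^ g] from the curvature,
    from [S] and from [kappa] add up to zero. *)
Lemma weyl_hypersurface X1 X2 X3 X4 : C X1 X2 X3 X4 =
  a1 * KN H H X1 X2 X3 X4 + a2 * KN g H X1 X2 X3 X4
  + a3 * KN g H2 X1 X2 X3 X4 + a4 * KN g g X1 X2 X3 X4.
Proof.
rewrite /C /weyl_of RiemE kappaE' SE /KN !(bilMD, bilMZ, bilMN) /mu.
by field; rewrite N1 N2.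
Qed.

(** The endomorphisms of [C] are skew with respect to [g]; in the formulas this is
    [Q(A, B) + Q(B, A) = 0]. *)
Let actg X Y U V : act2 (endo g C X Y) g U V = 0.
Proof.
rewrite (act2_endo_lin _ _ _ _ _ weyl_hypersurface) !act2_KN // !comp2gr.
rewrite /Q2; ring.
Qed.

(** Here the coefficient [tr H] in the cubic relation matters: the term [t Q(g, H^2)] that it
    produces from [g ^ H^2] cancels the one coming from [g ^ H]. *)
Let actH X Y U V : act2 (endo g C X Y) H U V =
  eps * (beta * Q2 H H2 X Y U V + alpha * Q2 g H X Y U V).
Proof.
rewrite (act2_endo_lin _ _ _ _ _ weyl_hypersurface) !act2_KN // !comp2gl.
rewrite HHE H2HE !Q2_lin /Q2 /beta /alpha /mu.
by field; rewrite N1 N2.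
Qed.

Let actH2 X Y U V : act2 (endo g C X Y) H2 U V =
  eps * (t * beta * Q2 H H2 X Y U V - rho * beta * Q2 g H X Y U V
         + alpha * Q2 g H2 X Y U V).
Proof.
rewrite (act2_endo_lin _ _ _ _ _ weyl_hypersurface) !act2_KN // !comp2gl.
rewrite HH2E H4E !Q2_lin /Q2 /beta /alpha /mu.
by field; rewrite N1 N2.
Qed.

Local Notation K P A B X1 X2 X3 X4 X Y := (KNf (bil P) (Q2 A B X Y) X1 X2 X3 X4).

(** By [actg] only the factors [H] and [H^2] are acted on. The terms [g ^ Q(H, H^2)] arising from
    [actH] and [actH2] cancel, and by [QC] the terms with [alpha] make up [alpha Q(g, W)]. *)
Let dotCC X1 X2 X3 X4 X Y : dotT g C C X1 X2 X3 X4 X Y =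
  beta * K H H H2 X1 X2 X3 X4 X Y + alpha * K H g H X1 X2 X3 X4 X Y
  - (N - 2)^-1 * (alpha * (t * K g g H X1 X2 X3 X4 X Y - K g g H2 X1 X2 X3 X4 X Y)
                 + rho * beta * K g g H X1 X2 X3 X4 X Y).
Proof.
rewrite /dotT (derivation_lin _ weyl_hypersurface) !derivation_KN /KNf.
rewrite !actg !actH !actH2.
by have [->|->] := eps_cases; field; rewrite N2.
Qed.

Let QC X1 X2 X3 X4 X Y : QT g C X1 X2 X3 X4 X Y =
  eps * (K H g H X1 X2 X3 X4 X Y
     - (N - 2)^-1 * (t * K g g H X1 X2 X3 X4 X Y - K g g H2 X1 X2 X3 X4 X Y)).
Proof.
rewrite /QT (derivation_lin _ weyl_hypersurface) !derivation_KN /KNf.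
rewrite !act2_wedge // !Q2_diag.
by field; rewrite N2.
Qed.

Hypothesis CC : forall X1 X2 X3 X4 X Y,
  dotT g C C X1 X2 X3 X4 X Y = LC * QT g C X1 X2 X3 X4 X Y.

Lemma contracted_identity Y X2 X3 X4 :
  ((kappa + 2 * eps * psi) / (N - 1) - N * c - LC) * C Y X2 X3 X4 =
  (N - 3) / ((N - 2) ^+ 2 * (N - 1)) * E_of g S kappa Y X2 X3 X4.
Proof.
have : \sum_i (dotT g C C (basis_vec R i) X2 X3 X4 (dual_vec i) Y
  - LC * QT g C (basis_vec R i) X2 X3 X4 (dual_vec i) Y) = 0.
  by apply: big1 => i _; rewrite CC subrr.
(* The summand is sorted so that each building block occurs once. As [C = eps W], the terms of
   [Q(g, W)] carry the factor [alpha - LC * eps]. *)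
under eq_bigr => i _.
  rewrite dotCC QC.
  have -> : beta * K H H H2 (basis_vec R i) X2 X3 X4 (dual_vec i) Y
   + alpha * K H g H (basis_vec R i) X2 X3 X4 (dual_vec i) Y
   - (N - 2)^-1 * (alpha * (t * K g g H (basis_vec R i) X2 X3 X4 (dual_vec i) Y
        - K g g H2 (basis_vec R i) X2 X3 X4 (dual_vec i) Y)
      + rho * beta * K g g H (basis_vec R i) X2 X3 X4 (dual_vec i) Y)
   - LC * (eps * (K H g H (basis_vec R i) X2 X3 X4 (dual_vec i) Y
     - (N - 2)^-1 * (t * K g g H (basis_vec R i) X2 X3 X4 (dual_vec i) Y
       - K g g H2 (basis_vec R i) X2 X3 X4 (dual_vec i) Y)))
   = beta * K H H H2 (basis_vec R i) X2 X3 X4 (dual_vec i) Y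
   + (alpha - LC * eps) * K H g H (basis_vec R i) X2 X3 X4 (dual_vec i) Y
   + (- (N - 2)^-1 * ((alpha - LC * eps) * t + rho * beta))
     * K g g H (basis_vec R i) X2 X3 X4 (dual_vec i) Y
   + (N - 2)^-1 * (alpha - LC * eps)
     * K g g H2 (basis_vec R i) X2 X3 X4 (dual_vec i) Y by ring.
  over.
rewrite !big_split /= -!mulr_sumr !contract_KN_Q2 //.
rewrite !(comp2gl, comp2gr) HHE HH2E H2HE tr2g !(bilMD, bilMZ).
(* With [T = t H - H^2] the cubic relation gives [T^2 = - psi T + rho H - rho t g], and
   [S = eps T + (n - 1) c g]. *)
move=> E; have SSE : square2 g S =
    (2 * eps * (N - 1) * c - psi) *: (t *: H - H2) + rho *: H
    + (((N - 1) * c) ^+ 2 - rho * t) *: g.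
  rewrite /square2 -/(comp2 S S) SE.
  rewrite -(scaleN1r H2) !(comp2Dr, comp2Zr, comp2Dl, comp2Zl, comp2gl, comp2gr).
  rewrite HHE HH2E H2HE H4E.
  apply/matrixP => i j; rewrite !mxE; move: (H2 i j) (H i j) (g i j) => x y z.
  by have [->|->] := eps_cases; ring.
have trSSE : tr2 g (square2 g S) =
    (2 * eps * (N - 1) * c - psi) * (t ^+ 2 - s2) + rho * t
    + (((N - 1) * c) ^+ 2 - rho * t) * N.
  by rewrite SSE -(scaleN1r H2) !(tr2D, tr2Z) tr2g; ring.
(* The contraction takes [Q(g, C)] to [(n - 1) C], so the claim is the contracted equation divided
   by [n - 1]. *)
apply: subr0_eq; rewrite -[RHS](mulr0 (N - 1)^-1) -{}E.
rewrite weyl_hypersurface /E_of trSSE SSE kappaE' SE /KN !(bilMD, bilMZ, bilMN).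
rewrite /alpha /beta /mu.
rewrite !(bilC X4 X2) // !(bilC X4 X3) // !(bilC X3 X2) //.
by have [-> | ->] := eps_cases; field; rewrite N1 N2.
Qed.

End Hypersurface.

End PointwiseTensors.

(** * Directional derivatives *)

Section Schwarz.
Variables (R : realType) (V : normedModType R).
Implicit Types (f : V -> R) (x y u v : V).

Lemma is_derive_line f y u (s : R) :
  derivable f (s *: u + y) u ->
  is_derive s 1 (fun r : R => f (r *: u + y)) ('D_u f (s *: u + y)).
Proof.
move=> df; have E : (fun h : R => h^-1 *: (f ((h *: 1 + s) *: u + y) - f (s *: u + y)))
    = (fun h => h^-1 *: (f (h *: u + (s *: u + y)) - f (s *: u + y))).
  by apply/funext => h; rewrite scalerDl [h *: 1]mulr1 addrA.
by split; rewrite /derivable /derive /= E.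
Qed.

Lemma line_MVT f y u (h : R) : 0 < h ->
  (forall s, s \in `[0, h] -> derivable f (s *: u + y) u) ->
  exists2 s, s \in `[0, h] & f (h *: u + y) - f y = h * 'D_u f (s *: u + y).
Proof.
move=> h0 df.
have [||s s0h] := @MVT_segment R (fun r : R => f (r *: u + y))
    (fun s => 'D_u f (s *: u + y)) 0 h (ltW h0).
- by move=> s s0h; apply/is_derive_line/df; apply: subset_itv_oo_cc.
- apply: derivable_within_continuous => s s0h.
  by have [] := is_derive_line (df s s0h).
by rewrite scale0r add0r subr0 mulrC => E; exists s.
Qed.

(** The mean value theorem is applied twice: to [y |-> f (h v + y) - f y] in the direction [u], then
    to ['D_u f] in the direction [v]. *)
Lemma second_difference f x u v (h : R) : 0 < h ->
  (forall s t, s \in `[0, h] -> t \in `[0, h] ->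
     derivable f (s *: u + (t *: v + x)) u /\
     derivable (fun y => 'D_u f y) (t *: v + (s *: u + x)) v) ->
  exists s t, [/\ s \in `[0, h], t \in `[0, h] &
    f (h *: u + (h *: v + x)) - f (h *: u + x) - f (h *: v + x) + f x
    = h * (h * 'D_v (fun y => 'D_u f y) (t *: v + (s *: u + x)))].
Proof.
move=> h0 df.
have i0 : 0 \in `[0, h] by rewrite in_itv /= lexx ltW.
have ih : h \in `[0, h] by rewrite in_itv /= lexx ltW.
pose phi (y : V) := f (h *: v + y) - f y.
have dphi s : s \in `[0, h] -> is_derive (s *: u + x) u phi
   ('D_u f (h *: v + (s *: u + x)) - 'D_u f (s *: u + x)).
  move=> si; have d1 : is_derive (s *: u + x) u (fun y => f (h *: v + y))
      ('D_u f (h *: v + (s *: u + x))).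
    have [d _] := df _ _ si ih; rewrite addrCA in d.
    have E : (fun r : R =>
        r^-1 *: (f (h *: v + (r *: u + (s *: u + x))) - f (h *: v + (s *: u + x))))
      = (fun r =>
        r^-1 *: (f (r *: u + (h *: v + (s *: u + x))) - f (h *: v + (s *: u + x)))).
      by apply/funext => r; rewrite addrCA.
    by split; rewrite /derivable /derive /= E.
  have [d2 _] := df _ _ si i0; rewrite scale0r add0r in d2.
  exact: is_deriveB d1 (derivableP d2).
have [|s si E1] := @line_MVT phi x u h h0; first by move=> s /dphi[].
have [_ E2] := dphi s si.
have [|t ti E3] := @line_MVT (fun y => 'D_u f y) (s *: u + x) v h h0.
  by move=> t ti; have [] := df _ _ si ti.
exists s, t; split=> //; rewrite -E3 -E2 -E1 /phi addrCA; ring.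
Qed.

(** The second difference is symmetric in [u] and [v], so the two mixed derivatives take equal
    values at two points arbitrarily close to [x]; their continuity at [x] does the rest. *)
Lemma derive_comm f (A : set V) x u v : open A -> A x ->
  (forall y, A y -> [/\ derivable f y u, derivable f y v,
     derivable (fun y => 'D_u f y) y v & derivable (fun y => 'D_v f y) y u]) ->
  {for x, continuous (fun y => 'D_v (fun z => 'D_u f z) y)} ->
  {for x, continuous (fun y => 'D_u (fun z => 'D_v f z) y)} ->
  'D_v (fun y => 'D_u f y) x = 'D_u (fun y => 'D_v f y) x.
Proof.
move=> oA Ax df cvu cuv; apply/eqP; rewrite -subr_eq0 -normr_le0.
apply/ler_addgt0Pr => e e0; rewrite add0r.
have e2 : 0 < e / 2 by rewrite divr_gt0.
have nA : nbhs x A by exact: open_nbhs_nbhs.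
have n1 : \forall y \near x,
  `|'D_v (fun z => 'D_u f z) x - 'D_v (fun z => 'D_u f z) y| < e / 2.
  by move/cvgrPdist_lt : cvu; apply.
have n2 : \forall y \near x,
  `|'D_u (fun z => 'D_v f z) x - 'D_u (fun z => 'D_v f z) y| < e / 2.
  by move/cvgrPdist_lt : cuv; apply.
have nP : nbhs x (A `&` ([set y |
    `|'D_v (fun z => 'D_u f z) x - 'D_v (fun z => 'D_u f z) y| < e / 2] `&`
  [set y | `|'D_u (fun z => 'D_v f z) x - 'D_u (fun z => 'D_v f z) y| < e / 2])).
  exact (filterI nA (filterI n1 n2)).
have /nbhs_ballP[r /= r0 rP] := nP.
(* With this [h], any [s u + t v] with [s] and [t] in [[0, h]] has norm at most [r / 2]; the summand
   [1] keeps the denominator positive. *)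
pose h := r / (2 * (1 + `|u| + `|v|)).
have d0 : 0 < 1 + `|u| + `|v| by rewrite -addrA ltr_pwDl // addr_ge0.
have h0 : 0 < h by rewrite divr_gt0 // mulr_gt0.
have inB s t : s \in `[0, h] -> t \in `[0, h] -> ball x r (s *: u + (t *: v + x)).
  rewrite !in_itv /= => /andP[s0 sh] /andP[t0 th].
  rewrite -ball_normE /= addrA opprD addrCA subrr addr0 normrN.
  apply: le_lt_trans (ler_normD _ _) _; rewrite !normrZ !ger0_norm //.
  apply: (@le_lt_trans _ _ (h * (1 + `|u| + `|v|))).
    by have := ler_wpM2r (normr_ge0 u) sh; have := ler_wpM2r (normr_ge0 v) th; lra.
  by rewrite /h invfM mulrA divfK ?gt_eqF // ltr_pdivrMr // ltr_pMr // ltr1n.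
have [|s [t [si ti E]]] := @second_difference f x u v h h0.
  move=> s t si ti; split; first by have [/df[? ? ? ?] _] := rP _ (inB _ _ si ti).
  by have [/df[_ _ d _] _] := rP _ (inB _ _ si ti); rewrite (addrCA (t *: v)).
have [|s' [t' [si' ti' E']]] := @second_difference f x v u h h0.
  move=> s' t' si' ti'; split.
    by have [/df[_ d _ _] _] := rP _ (inB _ _ ti' si'); rewrite (addrCA (s' *: v)).
  by have [/df[? ? ? ?] _] := rP _ (inB _ _ ti' si').
have [_ [b1 _]] := rP _ (inB _ _ si ti).
have [_ [_ b2]] := rP _ (inB _ _ ti' si').
have E2 : 'D_v (fun y => 'D_u f y) (s *: u + (t *: v + x)) =
    'D_u (fun y => 'D_v f y) (t' *: u + (s' *: v + x)).
  apply: (@mulfI _ (h * h)); first by rewrite mulf_neq0 // gt_eqF.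
  have X : f (h *: u + (h *: v + x)) - f (h *: u + x) - f (h *: v + x) + f x =
      f (h *: v + (h *: u + x)) - f (h *: v + x) - f (h *: u + x) + f x.
    by rewrite (addrCA (h *: u) (h *: v) x) [_ - _ - f (h *: v + x)]addrAC.
  rewrite (addrCA (s *: u) (t *: v) x).
  exact: etrans (esym (mulrA _ _ _)) (etrans (esym E) (etrans X (etrans E' (mulrA _ _ _)))).
rewrite (splitr e).
apply: le_trans (ler_distD ('D_v (fun y => 'D_u f y) (s *: u + (t *: v + x))) _ _) _.
apply: lerD; first exact: ltW b1.
rewrite E2 distrC; exact: ltW b2.
Qed.

End Schwarz.

(** * Product and chain rules for directional derivatives, also of matrix-valued functions *)

Section DirectionalDerivatives.
Variables (R : realType) (V : normedModType R).
Implicit Types (x u : V).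

Lemma is_derive_fctM (f g : V -> R) x u df dg :
  is_derive x u f df -> is_derive x u g dg ->
  is_derive x u (fun y => f y * g y) (df * g x + f x * dg).
Proof.
by move=> hf hg; apply: is_derive_eq (is_deriveM hf hg) _; rewrite addrC mulrC.
Qed.

Lemma is_derive_fctD (f g : V -> R) x u df dg :
  is_derive x u f df -> is_derive x u g dg ->
  is_derive x u (fun y => f y + g y) (df + dg).
Proof. exact: is_deriveD. Qed.

Lemma is_derive_fct_sum n (h : 'I_n -> V -> R) (dh : 'I_n -> R) x u :
  (forall i, is_derive x u (h i) (dh i)) ->
  is_derive x u (fun y => \sum_i h i y) (\sum_i dh i).
Proof.
move=> hh; have := is_derive_sum hh; congr (is_derive _ _ _ _).
by apply/funext => y; rewrite fct_sumE.
Qed.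

Lemma derivable_fct_prod (I : Type) (r : seq I) (h : I -> V -> R) x u :
  (forall i, derivable (h i) x u) -> derivable (fun y => \prod_(i <- r) h i y) x u.
Proof.
move=> hh; elim: r => [|i r IH].
  under eq_fun do rewrite big_nil; exact: derivable_cst.
by under eq_fun do rewrite big_cons; apply: derivableM.
Qed.

Lemma derivable_fct_sum (I : Type) (r : seq I) (h : I -> V -> R) x u :
  (forall i, derivable (h i) x u) -> derivable (fun y => \sum_(i <- r) h i y) x u.
Proof.
move=> hh; elim: r => [|i r IH].
  under eq_fun do rewrite big_nil; exact: derivable_cst.
by under eq_fun do rewrite big_cons; apply: derivableD.
Qed.

Lemma is_derive_mxP m n (M : V -> 'M[R]_(m, n)) (D : 'M[R]_(m, n)) x u :
  is_derive x u M D <-> forall i j, is_derive x u (fun y => M y i j) (D i j).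
Proof.
split=> [[dM <-] i j|dM].
  split; first exact: (derivable_mxP _ _ _).1.
  by rewrite derive_mx // mxE.
have dM' : derivable M x u by apply/derivable_mxP => i j; have [] := dM i j.
split=> //; rewrite derive_mx //; apply/matrixP => i j; rewrite mxE.
by have [] := dM i j.
Qed.

Lemma is_derive_bil n (A : V -> 'M[R]_n) (a b : V -> 'rV[R]_n) x u dA da db :
  is_derive x u A dA -> is_derive x u a da -> is_derive x u b db ->
  is_derive x u (fun y => bil (A y) (a y) (b y))
    (bil dA (a x) (b x) + bil (A x) da (b x) + bil (A x) (a x) db).
Proof.
move=> /is_derive_mxP hA /is_derive_mxP ha /is_derive_mxP hb.
under eq_fun do rewrite bil_sum.
rewrite !bil_sum -!big_split /=; apply: is_derive_fct_sum => i.
rewrite -!big_split /=; apply: is_derive_fct_sum => j.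
apply: is_derive_eq (is_derive_fctM (is_derive_fctM (ha 0 i) (hA i j)) (hb 0 j)) _.
ring.
Qed.

Lemma derivable_det n (A : V -> 'M[R]_n) x u :
  derivable A x u -> derivable (fun y => \det (A y)) x u.
Proof.
move=> /derivable_mxP dA; rewrite /determinant; apply: derivable_fct_sum => s.
apply: derivableM; first exact: derivable_cst.
by apply: derivable_fct_prod => i.
Qed.

(** Near [x] the inverse is the adjugate divided by the determinant, and both have polynomial
    entries in those of [A]. *)
Lemma derivable_invmx n (A : V -> 'M[R]_n) x u :
  (\forall y \near x, A y \in unitmx) -> derivable A x u ->
  derivable (fun y => invmx (A y)) x u.
Proof.
move=> uA dA; apply: (@near_eq_derivable _ _ _ (fun y => (\det (A y))^-1 *: \adj (A y))).
  by near=> y; rewrite /invmx ifT //; near: y.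
apply/derivable_mxP => i j.
under eq_fun do rewrite !mxE /cofactor.
have := nbhs_singleton uA; rewrite unitmxE unitfE => dA0.
apply: derivableM; first exact: derivableV (derivable_det dA).
apply: derivableM; first exact: derivable_cst.
apply: derivable_det; apply/derivable_mxP => k l.
under eq_fun do rewrite !mxE.
exact: (derivable_mxP _ _ _).1 dA _ _.
Unshelve. all: by end_near. Qed.

Lemma derivable_bil n (A : V -> 'M[R]_n) (a b : V -> 'rV[R]_n) x u :
  derivable A x u -> derivable a x u -> derivable b x u ->
  derivable (fun y => bil (A y) (a y) (b y)) x u.
Proof.
by move=> /derivableP dA /derivableP da /derivableP db; have [] := is_derive_bil dA da db.
Qed.

Lemma derive_bil_cst n (A : V -> 'M[R]_n) (a b : 'rV[R]_n) x u :
  derivable A x u -> 'D_u (fun y => bil (A y) a b) x = bil ('D_u A x) a b.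
Proof.
move=> /derivableP dA; have [_ ->] := is_derive_bil dA (is_derive_cst a x u) (is_derive_cst b x u).
by rewrite bil0l bil0r !addr0.
Qed.

Lemma derivable_mulmx m n p (A : V -> 'M[R]_(m, n)) (B : V -> 'M[R]_(n, p)) x u :
  derivable A x u -> derivable B x u -> derivable (fun y => A y *m B y) x u.
Proof.
move=> /derivable_mxP dA /derivable_mxP dB; apply/derivable_mxP => i j.
under eq_fun do rewrite mxE; apply: derivable_fct_sum => k.
exact: derivableM.
Qed.

Lemma is_derive_chain (W U : normedModType R) (f : V -> W) (g : W -> U) x u :
  differentiable f x -> differentiable g (f x) ->
  is_derive x u (g \o f) ('D_('D_u f x) g (f x)).
Proof.
move=> df dg; have dgf : differentiable (g \o f) x by exact: differentiable_comp.
split; first exact: diff_derivable.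
by rewrite !deriveE // diff_comp.
Qed.

Lemma deriveDv (W : normedModType R) (f : V -> W) x u v :
  differentiable f x -> 'D_(u + v) f x = 'D_u f x + 'D_v f x.
Proof. by move=> df; rewrite !deriveE // linearD. Qed.

Lemma deriveZv (W : normedModType R) (f : V -> W) x (a : R) u :
  differentiable f x -> 'D_(a *: u) f x = a *: 'D_u f x.
Proof. by move=> df; rewrite !deriveE // linearZ. Qed.

End DirectionalDerivatives.

(** * Christoffel symbols *)

(* otherwise unification unfolds the limits when two derivatives differ *)
#[local] Opaque derive.

Section SmoothMaps.
Variables (R : realType) (V W : normedModType R) (A : set V) (f : V -> W).
Hypothesis fA : smooth_on A f.

Lemma smooth_differentiable x : A x -> differentiable f x.
Proof. by have [+ _] := fA 1; apply. Qed.

Lemma smooth_derive v : smooth_on A (fun x => 'D_v f x).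
Proof. by move=> k; have [_ +] := fA k.+1; apply. Qed.

Lemma smooth_continuous x : A x -> {for x, continuous f}.
Proof. exact: fA 0 x. Qed.

Lemma smooth_derivable x v : A x -> derivable f x v.
Proof. by move=> Ax; apply/diff_derivable/smooth_differentiable. Qed.

End SmoothMaps.

Arguments smooth_derivable {R V W A f} fA x v Ax.
Arguments smooth_differentiable {R V W A f} fA x Ax.
Arguments smooth_continuous {R V W A f} fA x Ax.

(** Reduces to [derive_comm] for each coordinate. Taking a coordinate commutes with differentiation
    only on [A], so the iterated derivatives are compared near [x]. *)
Lemma smooth_derive_comm (R : realType) (V : normedModType R) m (A : set V)
    (f : V -> 'rV[R]_m) x u v : open A -> A x -> smooth_on A f ->
  'D_v (fun y => 'D_u f y) x = 'D_u (fun y => 'D_v f y) x.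
Proof.
move=> oA Ax sf; have nA : nbhs x A by exact: open_nbhs_nbhs.
have coord w j y : A y -> 'D_w f y 0 j = 'D_w (fun z => f z 0 j) y.
  by move=> Ay; rewrite derive_mx ?mxE //; exact: smooth_derivable sf _ _ Ay.
have coord2 w z j y : A y -> 'D_z (fun y => 'D_w f y) y 0 j =
    'D_z (fun y => 'D_w (fun y => f y 0 j) y) y.
  move=> Ay; rewrite derive_mx ?mxE; last exact: smooth_derivable (smooth_derive sf w) _ _ Ay.
  apply: near_eq_derive; have : nbhs y A by exact: open_nbhs_nbhs.
  apply: filterS => y' Ay'; exact (coord w j y' Ay').
apply/rowP => j.
apply: (etrans (coord2 u v j x Ax)).
apply: (etrans _ (esym (coord2 v u j x Ax))).
have cont w z : {for x, continuous (fun y => 'D_z (fun y => 'D_w (fun y => f y 0 j) y) y)}.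
  have c : {for x, continuous (fun y => 'D_z (fun y => 'D_w f y) y 0 j)}.
    apply: (@continuous_comp _ _ _ (fun y => 'D_z (fun y => 'D_w f y) y) (fun M => M 0 j)).
      exact: smooth_continuous (smooth_derive (smooth_derive sf w) z) _ Ax.
    exact: coord_continuous.
  rewrite /prop_for /continuous_at -(coord2 w z j x Ax).
  apply: cvg_trans c; apply: near_eq_cvg; apply: filterS nA => y Ay.
  exact (coord2 w z j y Ay).
apply: (@derive_comm _ _ _ A) => // y Ay.
have d1 w : derivable (fun y => f y 0 j) y w.
  exact: (derivable_mxP f y w).1 (smooth_derivable sf y w Ay) 0 j.
have d2 w z : derivable (fun y => 'D_w (fun y => f y 0 j) y) y z.
  have := (derivable_mxP (fun y => 'D_w f y) y z).1
    (smooth_derivable (smooth_derive sf w) y z Ay) 0 j.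
  apply: near_eq_derivable; have : nbhs y A by exact: open_nbhs_nbhs.
  apply: filterS => y' Ay'; exact (coord w j y' Ay').
by split.
Qed.

Section OpenSets.
Variables (R : realType) (V W : normedModType R) (A : set V) (f h : V -> W).
Variables (x u : V).
Hypotheses (oA : open A) (Ax : A x) (fh : forall y, A y -> f y = h y).

Let fh_near : \near x, f x = h x.
Proof.
have : nbhs x A by exact: open_nbhs_nbhs.
by apply: filterS => y Ay; exact (fh Ay).
Qed.

Lemma eq_on_derive : 'D_u f x = 'D_u h x.
Proof. exact: near_eq_derive fh_near. Qed.

Lemma eq_on_derivable : derivable f x u -> derivable h x u.
Proof. exact: near_eq_derivable fh_near. Qed.

Lemma eq_on_is_derive d : is_derive x u f d -> is_derive x u h d.
Proof. exact: near_eq_is_derive fh_near. Qed.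

End OpenSets.

(** * The Levi-Civita connection and the curvature of a metric on an open set *)

Section LocalMetric.
Variables (R : realType) (n : nat) (A : set 'rV[R]_n) (G : 'rV[R]_n -> 'M[R]_n).
Hypotheses (oA : open A) (sG : smooth_on A G).
Hypothesis symG : forall y, A y -> (G y)^T = G y.
Hypothesis unitG : forall y, A y -> G y \in unitmx.
Implicit Types (x y u v w z : 'rV[R]_n).

(* Christoffel symbols of the first kind *)
Definition christoffel1 y u v w : R :=
  2^-1 * (bil ('D_u G y) v w + bil ('D_v G y) u w - bil ('D_w G y) u v).

Lemma derive_bilG x u v w : A x -> 'D_u (fun y => bil (G y) v w) x = bil ('D_u G x) v w.
Proof. move=> Ax; exact: derive_bil_cst (smooth_derivable sG x u Ax). Qed.

Lemma derive_metric_sym x u : A x -> ('D_u G x)^T = 'D_u G x.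
Proof.
move=> Ax; apply/matrixP => i j; rewrite -!bil_basis.
have -> : bil ('D_u G x)^T (basis_vec R i) (basis_vec R j) =
    bil ('D_u G x) (basis_vec R j) (basis_vec R i) by rewrite !bil_basis mxE.
rewrite -!derive_bilG //; apply: (eq_on_derive (A := A)) => // y Ay.
exact/bilC/symG.
Qed.

(** [christoffel] is defined through its products with basis vectors only. Passing to all [w]
    requires ['D_w G] to be linear in [w], which comes from differentiability of [G]. *)
Lemma christoffel1_sum y u v w : A y ->
  christoffel1 y u v w = \sum_k christoffel1 y u v (basis_vec R k) * w 0 k.
Proof.
move=> Ay; have dG := smooth_differentiable sG y Ay.
have lin a w1 w2 : christoffel1 y u v (a *: w1 + w2) =
    a * christoffel1 y u v w1 + christoffel1 y u v w2.
  have D1 : 'D_(a *: w1 + w2) G y = a *: 'D_w1 G y + 'D_w2 G y.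
    by apply: (etrans (deriveDv _ _ dG)); congr (_ + _); exact: deriveZv.
  rewrite /christoffel1 {}D1; move: (derive G y) => D.
  rewrite !bilE bilMD bilMZ; ring.
have lin0 : christoffel1 y u v 0 = 0.
  have := lin 1 0 0; rewrite scaler0 addr0 mul1r => /eqP.
  by rewrite -[X in X == _]addr0 (inj_eq (addrI _)) => /eqP.
rewrite {1}(row_sum_delta w).
elim/big_rec2 : _ => [//|k a b _ <-].
by rewrite lin mulrC.
Qed.

Lemma bil_christoffel y u v w : A y ->
  bil (G y) (christoffel G y u v) w = christoffel1 y u v w.
Proof.
move=> Ay; rewrite /bil /christoffel -mulmxA -mulmxA (mulmxA (invmx _)).
rewrite mulVmx ?unitG // mul1mx mxE christoffel1_sum //.
apply: eq_bigr => k _; rewrite !mxE; congr (_ * _).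
by rewrite !derive_bilG.
Qed.

Lemma christoffelC y u v : A y -> christoffel G y u v = christoffel G y v u.
Proof.
move=> Ay; apply: (bil_inj (unitG Ay)) => w; rewrite !bil_christoffel //.
have := derive_metric_sym w Ay; rewrite /christoffel1.
by move: (derive G y) => D sD; rewrite (bilC u v sD) [bil (D u) v w + _]addrC.
Qed.

(** The connection is compatible with the metric: in the two Koszul formulas the derivatives along
    [v] and [w] cancel. *)
Lemma christoffel1_compat y u v w : A y ->
  christoffel1 y u v w + christoffel1 y u w v = bil ('D_u G y) v w.
Proof.
move=> Ay; have := fun a => derive_metric_sym a Ay; rewrite /christoffel1.
move: (derive G y) => D sD; rewrite (bilC w v (sD u)).
by field.
Qed.

Lemma derivable_christoffel1 x u v w z : A x ->
  derivable (fun y => christoffel1 y u v w) x z.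
Proof.
move=> Ax; have dG a : derivable (fun y => 'D_a G y) x z.
  exact: smooth_derivable (smooth_derive sG a) x z Ax.
have dB a b c : derivable (fun y => bil ('D_a G y) b c) x z.
  by apply: derivable_bil (dG a) _ _; exact: derivable_cst.
apply: derivableM; first exact: derivable_cst.
by apply: derivableB; first apply: derivableD.
Qed.

Lemma derivable_christoffel x u v w : A x ->
  derivable (fun y => christoffel G y v w) x u.
Proof.
move=> Ax; apply: derivable_mulmx.
  apply/derivable_mxP => i k; under eq_fun do rewrite mxE.
  apply: (@eq_on_derivable _ _ _ A (fun y => christoffel1 y v w (basis_vec R k))) => //.
    by move=> y Ay; rewrite !derive_bilG.
  exact: derivable_christoffel1.
apply: derivable_invmx; last exact: smooth_derivable sG x u Ax.
have : nbhs x A by exact: open_nbhs_nbhs.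
by apply: filterS => y; exact: unitG.
Qed.

(** By compatibility, the product of [z] with the covariant derivative of [Gamma(v, w)] along [u] is
    [D_u <Gamma(v, w), z> - <Gamma(u, z), Gamma(v, w)>]. The derivatives enter as [d1] and [d2] so
    that expressions obtained through an immersion can be supplied for them. *)
Lemma bil_curvature x u v w z d1 d2 : A x ->
  is_derive x u (fun y => christoffel1 y v w z) d1 ->
  is_derive x v (fun y => christoffel1 y u w z) d2 ->
  bil (G x) (curvature_at G x u v w) z =
    d1 - bil (G x) (christoffel G x u z) (christoffel G x v w)
    - (d2 - bil (G x) (christoffel G x v z) (christoffel G x u w)).
Proof.
move=> Ax [_ <-] [_ <-]; have nablaE a b : nabla G (cst a) (cst b) = (fun y => christoffel G y a b).
  by apply/funext => y; rewrite /nabla derive_cst add0r.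
(* Constant fields commute, so the bracket term of the curvature is a covariant derivative in the
   direction [0]. *)
have christoffel0 : christoffel G x 0 w = 0.
  apply: (bil_ndg (unitG Ax)) => z'; rewrite bil_christoffel //.
  have D0 : 'D_0 G x = 0 by exact: derive0.
  rewrite /christoffel1 {}D0; move: (derive G x) => D.
  by rewrite !bil0l /bil mulmx0 mul0mx mxE; ring.
have half a b : bil (G x) (nabla G (cst a) (nabla G (cst b) (cst w)) x) z =
    'D_a (fun y => christoffel1 y b w z) x
    - bil (G x) (christoffel G x a z) (christoffel G x b w).
  have [_ E0] := is_derive_bil (derivableP (smooth_derivable sG x a Ax))
    (derivableP (@derivable_christoffel x a b w Ax)) (is_derive_cst z x a).
  have E : 'D_a (fun y => christoffel1 y b w z) x =
      bil ('D_a G x) (christoffel G x b w) z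
      + bil (G x) ('D_a (fun y => christoffel G y b w) x) z.
    rewrite -[RHS]addr0 -[X in _ + X](bil0r (G x) (christoffel G x b w)) -[RHS]E0.
    by apply: (eq_on_derive (A := A)) => // y Ay; rewrite bil_christoffel.
  have compat := christoffel1_compat a (christoffel G x b w) z Ax.
  rewrite E -compat -(bil_christoffel a z _ Ax) nablaE /nabla bilDl.
  rewrite (bil_christoffel a (christoffel G x b w) z Ax).
  by move: (derive _) => D; ring.
have -> : curvature_at G x u v w = nabla G (cst u) (nabla G (cst v) (cst w)) x
    - nabla G (cst v) (nabla G (cst u) (cst w)) x.
  rewrite /curvature_at /curvature -[RHS]subr0; congr (_ - _).
  rewrite /nabla /lie_bracket.
  have -> : 'D_(cst u x) (cst v) x = 0 by exact: derive_cst.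
  have -> : 'D_(cst v x) (cst u) x = 0 by exact: derive_cst.
  rewrite subrr christoffel0 addr0; exact: derive0.
rewrite bilDl bilNl; congr (_ - _); [exact: half u v | exact: half v u].
Qed.

End LocalMetric.

(** * The Gauss equation in coordinates *)

Section CompositeMetric.
Variables (R : realType) (n m : nat) (A : set 'rV[R]_n) (B : set 'rV[R]_m).
Variables (GN : 'rV[R]_m -> 'M[R]_m) (f : 'rV[R]_n -> 'rV[R]_m).
Hypotheses (oA : open A) (oB : open B) (sGN : smooth_on B GN) (sf : smooth_on A f).
Hypothesis fAB : forall y, A y -> B (f y).

(** The first derivative of the metric as a function of three vectors, since along [f] the direction
    [a] varies with the point just like [b] and [c]. *)
Definition dmetric q a b c : R := bil ('D_a GN q) b c.

Lemma dmetric_sum q a b c : B q ->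
  dmetric q a b c = \sum_i a 0 i * dmetric q (basis_vec R i) b c.
Proof.
move=> Bq; have dG := smooth_differentiable sGN q Bq.
have lin k a1 a2 : dmetric q (k *: a1 + a2) b c = k * dmetric q a1 b c + dmetric q a2 b c.
  have D1 : 'D_(k *: a1 + a2) GN q = k *: 'D_a1 GN q + 'D_a2 GN q.
    by apply: (etrans (deriveDv _ _ dG)); congr (_ + _); exact: deriveZv.
  by rewrite /dmetric {}D1 bilMD bilMZ.
have lin0 : dmetric q 0 b c = 0.
  have D0 : 'D_0 GN q = 0 by exact: derive0.
  by rewrite /dmetric {}D0 /bil mulmx0 mul0mx mxE.
rewrite {1}(row_sum_delta a); elim/big_rec2 : _ => [//|k s t _ <-]; exact: lin.
Qed.

(** Expanding the moving direction [a] in the basis leaves derivatives of [GN] in fixed directions,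
    to which the chain and product rules apply. *)
Lemma is_derive_dmetric x u (a b c : 'rV[R]_n -> 'rV[R]_m) da db dc d : A x ->
  is_derive (f x) ('D_u f x) (fun q => dmetric q (a x) (b x) (c x)) d ->
  is_derive x u a da -> is_derive x u b db -> is_derive x u c dc ->
  is_derive x u (fun y => dmetric (f y) (a y) (b y) (c y))
    (d + dmetric (f x) da (b x) (c x) + dmetric (f x) (a x) db (c x)
     + dmetric (f x) (a x) (b x) dc).
Proof.
move=> Ax [_ <-] ha hb hc; have Bfx := fAB Ax.
have sD i := smooth_derive sGN (basis_vec R i).
pose E i := 'D_('D_u f x) (fun q => 'D_(basis_vec R i) GN q) (f x).
have hE i : is_derive x u (fun y => 'D_(basis_vec R i) GN (f y)) (E i).
  apply: (is_derive_chain (f := f) (g := fun q => 'D_(basis_vec R i) GN q)).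
    exact: smooth_differentiable sf x Ax.
  exact: smooth_differentiable (sD i) (f x) Bfx.
have -> : 'D_('D_u f x) (fun q => dmetric q (a x) (b x) (c x)) (f x) =
    \sum_i a x 0 i * bil (E i) (b x) (c x).
  have [_ <-] : is_derive (f x) ('D_u f x)
     (fun q => \sum_i a x 0 i * bil ('D_(basis_vec R i) GN q) (b x) (c x))
     (\sum_i a x 0 i * bil (E i) (b x) (c x)).
    apply: is_derive_fct_sum => i.
    have dE := derivableP (smooth_derivable (sD i) (f x) ('D_u f x) Bfx).
    apply: is_derive_eq (is_derive_fctM (is_derive_cst _ _ _)
      (is_derive_bil dE (is_derive_cst (b x) _ _) (is_derive_cst (c x) _ _))) _.
    by rewrite bil0l bil0r mul0r add0r !addr0.
  apply: (eq_on_derive (A := B)) => // q Bq; exact: dmetric_sum.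
rewrite (dmetric_sum da) // (dmetric_sum (a x) db) // (dmetric_sum (a x) (b x) dc) //.
apply: (@eq_on_is_derive _ _ _ A
  (fun y => \sum_i a y 0 i * dmetric (f y) (basis_vec R i) (b y) (c y))) => //.
  by move=> y Ay; rewrite -dmetric_sum //; exact: fAB.
rewrite -!big_split /=; apply: is_derive_fct_sum => i.
have hai := (is_derive_mxP _ _ _ _).1 ha 0 i.
apply: is_derive_eq (is_derive_fctM hai (is_derive_bil (hE i) hb hc)) _.
rewrite /dmetric; move: (E i) ('D_(basis_vec R i) GN (f x)) => E1 E2; ring.
Qed.

Lemma derivable_dmetric q p a b c : B q -> derivable (fun q => dmetric q a b c) q p.
Proof.
move=> Bq; have dG := smooth_derivable (smooth_derive sGN a) q p Bq.
exact: derivable_bil dG (derivable_cst b q p) (derivable_cst c q p).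
Qed.

Lemma christoffel1E q a b c : christoffel1 GN q a b c =
  2^-1 * (dmetric q a b c + dmetric q b a c - dmetric q c a b).
Proof. by []. Qed.

Lemma is_derive_christoffel1 x u (a b c : 'rV[R]_n -> 'rV[R]_m) da db dc d : A x ->
  is_derive (f x) ('D_u f x) (fun q => christoffel1 GN q (a x) (b x) (c x)) d ->
  is_derive x u a da -> is_derive x u b db -> is_derive x u c dc ->
  is_derive x u (fun y => christoffel1 GN (f y) (a y) (b y) (c y))
    (d + christoffel1 GN (f x) da (b x) (c x) + christoffel1 GN (f x) (a x) db (c x)
     + christoffel1 GN (f x) (a x) (b x) dc).
Proof.
move=> Ax [_ <-] ha hb hc; have Bfx := fAB Ax.
have ex a1 a2 a3 : exists d, is_derive (f x) ('D_u f x) (fun q => dmetric q a1 a2 a3) d.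
  by eexists; apply: derivableP; exact: derivable_dmetric.
have [[d1 hd1] [d2 hd2] [d3 hd3]] :
  [/\ exists d, is_derive (f x) ('D_u f x) (fun q => dmetric q (a x) (b x) (c x)) d,
      exists d, is_derive (f x) ('D_u f x) (fun q => dmetric q (b x) (a x) (c x)) d &
      exists d, is_derive (f x) ('D_u f x) (fun q => dmetric q (c x) (a x) (b x)) d].
  by split; exact: ex.
have h1 := is_derive_dmetric Ax hd1 ha hb hc.
have h2 := is_derive_dmetric Ax hd2 hb ha hc.
have h3 := is_derive_dmetric Ax hd3 hc ha hb.
have [_ ->] : is_derive (f x) ('D_u f x)
    (fun q => christoffel1 GN q (a x) (b x) (c x)) _ :=
  is_deriveZ 2^-1 (is_deriveB (is_deriveD hd1 hd2) hd3).
apply: is_derive_eq (is_deriveZ 2^-1 (is_deriveB (is_deriveD h1 h2) h3)) _.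
rewrite !christoffel1E; move: (dmetric (f x)) => p.
rewrite -![2^-1 *: _]/(2^-1 * _).
ring.
Qed.
End CompositeMetric.

(** The vector [xi] is not null and is orthogonal to the image of [L], which has codimension one;
    together they span the space. The difference of the two sides is orthogonal to both, hence zero
    by nondegeneracy. *)
Lemma normal_multiple (R : realType) n m (g : 'M[R]_m) (L : 'rV[R]_n -> 'rV[R]_m)
    (eps : R) xi N : g^T = g -> g \in unitmx -> m = n.+1 ->
  (forall k a b, L (k *: a + b) = k *: L a + L b) -> injective L -> eps ^+ 2 = 1 ->
  bil g xi xi = eps -> (forall u, bil g (L u) xi = 0) ->
  (forall u, bil g N (L u) = 0) -> N = (eps * bil g N xi) *: xi.
Proof.
move=> gT gU mn; move: mn g gT gU L xi N => -> g gT gU L xi N linL injL eps2 nxi txi tN.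
have L0 : L 0 = 0 by have := linL (-1) 0 0; rewrite scaleN1r oppr0 addr0 scaleN1r addNr.
have LE (a : 'rV[R]_n) : L a = a *m lin1_mx L.
  rewrite {1}(row_sum_delta a) mulmx_sum_row.
  elim/big_rec2 : _ => [//|k s t _ <-]; rewrite linL; congr (_ *: _ + _).
  by apply/rowP => j; rewrite !mxE.
pose P : 'M[R]_(1 + n, n.+1) := col_mx xi (lin1_mx L).
have PE (v : 'rV[R]_(1 + n)) : v *m P = lsubmx v 0 0 *: xi + L (rsubmx v).
  by rewrite -{1}[v]hsubmxK mul_row_col -LE -mul_scalar_mx -mx11_scalar.
have kerP (v : 'rV[R]_(1 + n)) : v *m P = 0 -> v = 0.
  rewrite PE => E; have := congr1 (fun q => bil g q xi) E.
  rewrite /= bilDl bilZl txi nxi bil0l addr0 => /eqP.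
  have e0 : eps != 0 by apply/eqP => e0; move/eqP: eps2; rewrite e0 expr0n /= eq_sym oner_eq0.
  rewrite mulf_eq0 (negbTE e0) orbF => /eqP a0.
  move: E; rewrite a0 scale0r add0r -[X in _ = X]L0 => /injL b0.
  by rewrite -[v]hsubmxK b0 [lsubmx _]mx11_scalar a0 raddf0 row_mx0.
have uP : (P : 'M[R]_n.+1) \in unitmx.
  by rewrite -row_free_unit; apply: inj_row_free => v E; exact: (kerP v E).
apply/subr0_eq/(@bil_ndg _ _ g) => // Y; set N' := N - _.
have -> : Y = (Y *m invmx P) *m P by rewrite mulmxKV.
rewrite PE bilDr bilZr /N'.
have -> a : bil g (N - (eps * bil g N xi) *: xi) (L a) = 0.
  by rewrite bilDl bilNl bilZl tN (bilC xi _ gT) txi mulr0 subrr.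
by rewrite bilDl bilNl bilZl nxi mulrAC -expr2 eps2 mul1r subrr mulr0 addr0.
Qed.

(** * The Gauss equation for an isometric immersion of coordinate domains *)

Section Immersion.
Variables (R : realType) (n m : nat) (A : set 'rV[R]_n) (B : set 'rV[R]_m).
Variables (G : 'rV[R]_n -> 'M[R]_n) (GN : 'rV[R]_m -> 'M[R]_m).
Variable f : 'rV[R]_n -> 'rV[R]_m.
Hypotheses (oA : open A) (sG : smooth_on A G).
Hypothesis symG : forall y, A y -> (G y)^T = G y.
Hypothesis unitG : forall y, A y -> G y \in unitmx.
Hypotheses (oB : open B) (sGN : smooth_on B GN).
Hypothesis symGN : forall y, B y -> (GN y)^T = GN y.
Hypothesis unitGN : forall y, B y -> GN y \in unitmx.
Hypotheses (sf : smooth_on A f) (fAB : forall y, A y -> B (f y)).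
Hypothesis pullback : forall y, A y -> forall u v,
  bil (G y) u v = bil (GN (f y)) ('D_u f y) ('D_v f y).

Definition hessian u v y : 'rV[R]_m := 'D_u (fun z => 'D_v f z) y.
(** The ambient covariant derivative, in the direction [u], of the field ['D_v f] along [f]. *)
Definition ambient u v y : 'rV[R]_m :=
  hessian u v y + christoffel GN (f y) ('D_u f y) ('D_v f y).

Lemma hessianC u v y : A y -> hessian u v y = hessian v u y.
Proof. move=> Ay; exact: (smooth_derive_comm v u oA Ay sf). Qed.

Lemma is_derive_dmap u v y : A y -> is_derive y u (fun z => 'D_v f z) (hessian u v y).
Proof. move=> Ay; exact/derivableP/(smooth_derivable (smooth_derive sf v) y u Ay). Qed.

Lemma is_derive_metric_f u y : A y ->
  is_derive y u (fun z => GN (f z)) ('D_('D_u f y) GN (f y)).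
Proof.
move=> Ay; apply: (is_derive_chain (f := f) (g := GN)).
  exact: smooth_differentiable sf y Ay.
exact: smooth_differentiable sGN (f y) (fAB Ay).
Qed.

(** Differentiating the pulled-back metric produces six terms with second derivatives of [f]; by
    their symmetry all but the one in [hessian u v y] cancel in the Koszul formula. *)
Lemma christoffel1_pullback y u v w : A y -> christoffel1 G y u v w =
  bil (GN (f y)) (hessian u v y) ('D_w f y)
  + christoffel1 GN (f y) ('D_u f y) ('D_v f y) ('D_w f y).
Proof.
move=> Ay; have By := fAB Ay.
have dG a b c : bil ('D_a G y) b c = dmetric GN (f y) ('D_a f y) ('D_b f y) ('D_c f y)
    + bil (GN (f y)) (hessian a b y) ('D_c f y)
    + bil (GN (f y)) ('D_b f y) (hessian a c y).
  apply: (etrans (esym (derive_bilG sG a b c Ay))).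
  have [_ <-] := is_derive_bil (is_derive_metric_f a Ay) (is_derive_dmap a b Ay)
    (is_derive_dmap a c Ay).
  apply: (eq_on_derive _ oA Ay) => z Az; exact: pullback.
rewrite [LHS]/christoffel1 !dG christoffel1E.
rewrite (hessianC v u Ay) (hessianC w u Ay) (hessianC w v Ay).
have sb a b := bilC a b (symGN By).
move: (hessian u v y) (hessian u w y) (hessian v w y) (derive f y) => h1 h2 h3 F.
rewrite (sb (F u) h3) (sb (F v) h2).
move: (bil _) (dmetric _ _) => b p.
by field.
Qed.

Lemma is_derive_christoffel1_pullback x a v w z h d : A x ->
  is_derive x a (fun y => hessian v w y) h ->
  is_derive (f x) ('D_a f x) (fun q => christoffel1 GN q ('D_v f x) ('D_w f x) ('D_z f x)) d ->
  is_derive x a (fun y => christoffel1 G y v w z)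
   (christoffel1 GN (f x) ('D_a f x) (hessian v w x) ('D_z f x)
    + christoffel1 GN (f x) ('D_a f x) ('D_z f x) (hessian v w x)
    + bil (GN (f x)) h ('D_z f x)
    + bil (GN (f x)) (hessian v w x) (hessian a z x)
    + (d + christoffel1 GN (f x) (hessian a v x) ('D_w f x) ('D_z f x)
       + christoffel1 GN (f x) ('D_v f x) (hessian a w x) ('D_z f x)
       + christoffel1 GN (f x) ('D_v f x) ('D_w f x) (hessian a z x))).
Proof.
move=> Ax hh hd; have Bx := fAB Ax.
have h1 := is_derive_christoffel1 oA oB sGN sf fAB Ax hd (is_derive_dmap a v Ax)
  (is_derive_dmap a w Ax) (is_derive_dmap a z Ax).
have h2 := is_derive_bil (is_derive_metric_f a Ax) hh (is_derive_dmap a z Ax).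
have E y : A y -> bil (GN (f y)) (hessian v w y) ('D_z f y)
    + christoffel1 GN (f y) ('D_v f y) ('D_w f y) ('D_z f y) = christoffel1 G y v w z.
  by move=> Ay; apply/esym; exact: christoffel1_pullback.
apply: (eq_on_is_derive oA Ax E).
apply: is_derive_eq (is_derive_fctD h2 h1) _.
by rewrite -(christoffel1_compat oB sGN symGN _ _ _ Bx).
Qed.

(** [bil_curvature] is applied on both sides. The third derivative of [f] is symmetric in [u] and
    [v] and cancels, and the derivatives [d1] and [d2] of the ambient symbols are common to both
    expressions. *)
Lemma gauss_ambient x u v w z : A x ->
  bil (G x) (curvature_at G x u v w) z =
  bil (GN (f x)) (curvature_at GN (f x) ('D_u f x) ('D_v f x) ('D_w f x)) ('D_z f x)
  + (bil (GN (f x)) (ambient v w x) (ambient u z x)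
     - bil (G x) (christoffel G x v w) (christoffel G x u z))
  - (bil (GN (f x)) (ambient u w x) (ambient v z x)
     - bil (G x) (christoffel G x u w) (christoffel G x v z)).
Proof.
move=> Ax; have Bx := fAB Ax.
have ex p a b c : exists d, is_derive (f x) p (fun q => christoffel1 GN q a b c) d.
  by eexists; apply: derivableP; exact: (derivable_christoffel1 sGN).
have [[d1 hd1] [d2 hd2]] :
 (exists d, is_derive (f x) ('D_u f x)
   (fun q => christoffel1 GN q ('D_v f x) ('D_w f x) ('D_z f x)) d) /\
 (exists d, is_derive (f x) ('D_v f x)
   (fun q => christoffel1 GN q ('D_u f x) ('D_w f x) ('D_z f x)) d).
  by split; exact: ex.
have [h [hu hv]] : exists h, is_derive x u (fun y => hessian v w y) h /\
    is_derive x v (fun y => hessian u w y) h.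
  have dh a b := derivableP (smooth_derivable (smooth_derive (smooth_derive sf w) b) x a Ax).
  exists ('D_u (fun y => hessian v w y) x); split; first exact: dh.
  apply: is_derive_eq (dh v u) _.
  exact: smooth_derive_comm oA Ax (smooth_derive sf w).
have C1 := bil_curvature oA sG symG unitG Ax
  (is_derive_christoffel1_pullback Ax hu hd1) (is_derive_christoffel1_pullback Ax hv hd2).
have C2 := bil_curvature oB sGN symGN unitGN Bx hd1 hd2.
apply: (etrans C1).
apply: (etrans _ (congr1 (fun q => q + _ - _) (esym C2))).
have -> : hessian v u x = hessian u v x by exact: hessianC.
rewrite /ambient; clear C1 C2 hu hv hd1 hd2.
move: (hessian u v x) (hessian v w x) (hessian u w x) (hessian u z x) (hessian v z x)
  => huv hvw huw huz hvz.
move: ('D_u f x) ('D_v f x) ('D_w f x) ('D_z f x) => fu fv fw fz.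
have bc a b c : bil (GN (f x)) c (christoffel GN (f x) a b) = christoffel1 GN (f x) a b c.
  rewrite (bilC _ _ (symGN Bx)); exact: bil_christoffel.
have bc' a b c : bil (GN (f x)) (christoffel GN (f x) a b) c = christoffel1 GN (f x) a b c.
  exact: bil_christoffel.
move: (bil (G x)) (christoffel G x) (fun a b => bilC a b (symG Ax)) => bG pG sbG.
rewrite (sbG (pG u z)) (sbG (pG v z)).
move: (christoffel1 GN (f x)) bc bc' => c1.
move: (bil (GN (f x))) (christoffel GN (f x)) (bilDl (GN (f x))) (bilDr (GN (f x)))
  (fun a b => bilC a b (symGN Bx)) => b p bDl bDr sb bc bc'.
rewrite (sb (p fu fz) (p fv fw)) (sb (p fv fz) (p fu fw)).
rewrite !bDl !bDr !bc !bc'.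
ring.
Qed.

Lemma christoffel_linl k a b c y : B y ->
  christoffel GN y (k *: a + b) c = k *: christoffel GN y a c + christoffel GN y b c.
Proof.
move=> By; apply: (bil_inj (unitGN By)) => w.
have E a1 := bil_christoffel sGN unitGN a1 c w By.
rewrite bilDl bilZl; apply: (etrans (E (k *: a + b))).
apply: (etrans _ (esym (congr2 (fun p q => k * p + q) (E a) (E b)))).
have D1 : 'D_(k *: a + b) GN y = k *: 'D_a GN y + 'D_b GN y.
  have dG := smooth_differentiable sGN y By.
  by apply: (etrans (deriveDv _ _ dG)); congr (_ + _); exact: deriveZv.
rewrite /christoffel1 {}D1; move: (derive GN y) => D.
rewrite !bilE bilMD bilMZ; ring.
Qed.

Lemma ambientC u v x : A x -> ambient u v x = ambient v u x.
Proof.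
move=> Ax; have E2 := christoffelC oB sGN symGN unitGN ('D_u f x) ('D_v f x) (fAB Ax).
exact: (congr2 (fun a b => a + b) (hessianC u v Ax) E2).
Qed.

Lemma ambient_linl k u v w x : A x ->
  ambient (k *: u + v) w x = k *: ambient u w x + ambient v w x.
Proof.
move=> Ax; have dF := smooth_differentiable (smooth_derive sf w) x Ax.
have H1 : hessian (k *: u + v) w x = k *: hessian u w x + hessian v w x.
  by apply: (etrans (deriveDv _ _ dF)); congr (_ + _); exact: deriveZv.
have F1 : 'D_(k *: u + v) f x = k *: 'D_u f x + 'D_v f x.
  have df := smooth_differentiable sf x Ax.
  by apply: (etrans (deriveDv _ _ df)); congr (_ + _); exact: deriveZv.
rewrite /ambient {}H1 {}F1 christoffel_linl; last exact: fAB.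
have scale_add (p q r s : 'rV[R]_m) : k *: p + q + (k *: r + s) = k *: (p + r) + (q + s).
  by rewrite scalerDr addrACA.
exact: scale_add.
Qed.

(** The tangential part of the ambient derivative is the intrinsic one; both sides are the
    Christoffel symbol of the first kind. *)
Lemma bil_ambient u v w x : A x ->
  bil (GN (f x)) (ambient u v x) ('D_w f x) = bil (G x) (christoffel G x u v) w.
Proof.
move=> Ax; rewrite (bil_christoffel sG unitG _ _ _ Ax) christoffel1_pullback // /ambient bilDl.
by congr (_ + _); apply: (bil_christoffel sGN unitGN); exact: fAB.
Qed.

(** [bil_ambient] and [normal_multiple] split the ambient derivative as the image of [christoffel]
    plus [eps h xi]. In [gauss_ambient] the tangential products cancel, and the normal ones leave
    [eps^3 h h = eps h h]. *)
Lemma gauss_equation (eps : R) xi x u v w z : A x -> m = n.+1 ->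
  injective (fun u => 'D_u f x) -> eps ^+ 2 = 1 ->
  bil (GN (f x)) xi xi = eps -> (forall u, bil (GN (f x)) ('D_u f x) xi = 0) ->
  let h a b := bil (GN (f x)) (ambient a b x) xi in
  bil (G x) (curvature_at G x u v w) z =
  bil (GN (f x)) (curvature_at GN (f x) ('D_u f x) ('D_v f x) ('D_w f x)) ('D_z f x)
  + eps * (h u z * h v w - h u w * h v z).
Proof.
move=> Ax mn injF eps2 nxi txi h; have Bx := fAB Ax.
have linF k a b : 'D_(k *: a + b) f x = k *: 'D_a f x + 'D_b f x.
  have df := smooth_differentiable sf x Ax.
  by apply: (etrans (deriveDv _ _ df)); congr (_ + _); exact: deriveZv.
have ambE a b : ambient a b x = 'D_(christoffel G x a b) f x + (eps * h a b) *: xi.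
  apply/eqP; rewrite addrC -subr_eq; apply/eqP.
  have -> : h a b = bil (GN (f x)) (ambient a b x - 'D_(christoffel G x a b) f x) xi.
    by rewrite bilDl bilNl txi subr0.
  apply: (normal_multiple (symGN Bx) (unitGN Bx) mn linF injF eps2 nxi txi) => c.
  by rewrite bilDl bilNl bil_ambient // -pullback // subrr.
have prod a b c d : bil (GN (f x)) (ambient a b x) (ambient c d x)
    - bil (G x) (christoffel G x a b) (christoffel G x c d) = eps * (h a b * h c d).
  have P := pullback Ax (christoffel G x a b) (christoffel G x c d).
  rewrite {}P {1}ambE [X in bil _ _ X]ambE.
  have tx a' b' := txi (christoffel G x a' b').
  move: (tx a b) (tx c d); move: (h a b) (h c d) => h1 h2.
  move: (derive f x (christoffel G x a b)) (derive f x (christoffel G x c d)) => p q tp tq.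
  rewrite !bilDl !bilDr !bilZl !bilZr (bilC xi q (symGN Bx)) tp tq nxi.
  by rewrite !mulr0 add0r addr0 addrC addKr -[RHS]mul1r -eps2; ring.
apply: (etrans (gauss_ambient u v w z Ax)).
apply: (etrans (congr2 (fun p q => _ + p - q) (prod v w u z) (prod u w v z))).
have regroup (q a b c d : R) : q + eps * (a * b) - eps * (c * d) =
    q + eps * (b * a - c * d) by ring.
exact: regroup.
Qed.

Definition second_form xi x : 'M[R]_n :=
  \matrix_(i, j) bil (GN (f x)) (ambient (basis_vec R i) (basis_vec R j) x) xi.

Lemma second_formT xi x : A x -> (second_form xi x)^T = second_form xi x.
Proof. by move=> Ax; apply/matrixP => i j; rewrite !mxE ambientC. Qed.

(** The matrix only records values on basis vectors; linearity in the first argument and symmetry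
    recover all others. *)
Lemma bil_second_form xi x u v : A x ->
  bil (second_form xi x) u v = bil (GN (f x)) (ambient u v x) xi.
Proof.
move=> Ax; pose h a b := bil (GN (f x)) (ambient a b x) xi.
have hl k a b c : h (k *: a + b) c = k * h a c + h b c.
  by rewrite /h ambient_linl // bilDl bilZl.
have hC a b : h a b = h b a by rewrite /h ambientC.
have h0 a : h 0 a = 0.
  by have := hl (-1) 0 0 a; rewrite scaleN1r oppr0 addr0 mulN1r addNr.
have hsum a b : h a b = \sum_i a 0 i * h (basis_vec R i) b.
  rewrite {1}(row_sum_delta a); elim/big_rec2 : _ => [//|k s t _ <-]; exact: hl.
rewrite -/(h u v) hsum bil_sum; apply: eq_bigr => i _.
rewrite hC hsum mulr_sumr; apply: eq_bigr => j _.
by rewrite mxE -/(h _ _) (hC (basis_vec R j)) mulrAC mulrA.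
Qed.

End Immersion.

(** * Charts and isometric immersions *)

Lemma smooth_on_sub (R : realType) (V W : normedModType R) (A B : set V) (f : V -> W) :
  A `<=` B -> smooth_on B f -> smooth_on A f.
Proof.
move=> AB sf k; move: (sf k); elim: k f {sf} => [|k IH] f /=.
  by move=> c x /AB; exact: c.
by move=> [d c]; split=> [x /AB|v]; [exact: d | exact: IH (c v)].
Qed.

(** * Changes of coordinates and the metric in a chart *)

Section Charts.
Variables (R : realType) (n : nat) (M : manifold R n).
Implicit Types (p q : M) (y : 'rV[R]_n).

Lemma chart_image_open (T : topologicalType) (phi : chart R n T) (D : set T) :
  open D -> D `<=` chart_dom phi -> open (phi @` D).
Proof.
move=> oD Dphi; rewrite openE => _ [q Dq <-].
have cq : chart_cod phi (phi q) by exists q => //; exact: Dphi.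
have n1 : nbhs (phi q) (chart_cod phi).
  by apply: open_nbhs_nbhs; split=> //; exact: chart_cod_open.
have n2 : nbhs (phi q) (chart_inv phi @^-1` D).
  apply: (chart_inv_continuous cq); rewrite chart_mapK; last exact: Dphi.
  exact: open_nbhs_nbhs.
apply: filterS (filterI n1 n2) => _ [[r rphi <-] /=]; rewrite chart_mapK //.
by move=> Dr; exists r.
Qed.

Lemma chart_invK (T : topologicalType) (phi : chart R n T) y :
  chart_cod phi y -> chart_dom phi (chart_inv phi y) /\ phi (chart_inv phi y) = y.
Proof. by move=> [q qphi <-]; rewrite chart_mapK. Qed.

Definition overlap p q : set 'rV[R]_n :=
  chart_at p @` (chart_dom (chart_at p) `&` chart_dom (chart_at q)).

Definition transition p q : 'rV[R]_n -> 'rV[R]_n := chart_at q \o chart_inv (chart_at p).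

Lemma overlap_open p q : open (overlap p q).
Proof. by apply: chart_image_open; [apply: openI; exact: chart_dom_open | move=> r []]. Qed.

Lemma overlap_self p y : chart_cod (chart_at p) y ->
  overlap p (chart_inv (chart_at p) y) y.
Proof.
move=> /[dup] cy /chart_invK[dy yK]; exists (chart_inv (chart_at p) y) => //.
by split=> //; exact: chart_at_mem.
Qed.

Lemma transition_differentiable p q y : overlap p q y ->
  differentiable (transition p q) y.
Proof. exact: (smooth_differentiable (transition_smooth p q)). Qed.

Lemma transitionK p q y : overlap p q y -> transition q p (transition p q y) = y.
Proof. by move=> [r [rp rq] <-]; rewrite /transition /= !chart_mapK. Qed.

Lemma overlap_transition p q y : overlap p q y -> overlap q p (transition p q y).
Proof. by move=> [r [rp rq] <-]; exists r => //; rewrite /transition /= chart_mapK. Qed.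

Lemma derive_transitionK p q y u : overlap p q y ->
  'D_('D_u (transition p q) y) (transition q p) (transition p q y) = u.
Proof.
move=> oy; have [_ <-] := is_derive_chain u (transition_differentiable oy)
  (transition_differentiable (overlap_transition oy)).
have -> : 'D_u (transition q p \o transition p q) y = 'D_u id y.
  apply: (eq_on_derive u (@overlap_open p q) oy) => z oz; exact: transitionK.
exact: derive_id.
Qed.

Lemma bil_congr (P g : 'M[R]_n) (u v : 'rV[R]_n) :
  bil (P *m g *m P^T) u v = bil g (u *m P) (v *m P).
Proof. by rewrite /bil trmx_mul !mulmxA. Qed.

Variable g : metric M.

Lemma local_gramE p y : chart_cod (chart_at p) y ->
  let q := chart_inv (chart_at p) y in let J := jacobian (transition p q) y in
  local_gram g p y = J *m g q *m J^T.
Proof.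
move=> cy q J; have dT := transition_differentiable (overlap_self cy).
apply/matrixP => i j; rewrite mxE -bil_basis bil_congr /J.
have E v := esym (deriveEjacobian v dT).
by rewrite !E.
Qed.

Lemma bil_local_gram p y u v : chart_cod (chart_at p) y ->
  let q := chart_inv (chart_at p) y in
  bil (local_gram g p y) u v =
  bil (g q) ('D_u (transition p q) y) ('D_v (transition p q) y).
Proof.
move=> cy q; have dT := transition_differentiable (overlap_self cy).
rewrite local_gramE // bil_congr.
by rewrite -(deriveEjacobian u dT) -(deriveEjacobian v dT).
Qed.

Lemma local_gramT p y : (local_gram g p y)^T = local_gram g p y.
Proof. apply/matrixP => i j; rewrite !mxE; exact/bilC/gram_sym. Qed.

Lemma local_gram_unit p y : chart_cod (chart_at p) y -> local_gram g p y \in unitmx.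
Proof.
move=> cy; rewrite local_gramE //; set q := chart_inv _ y; set J := jacobian _ y.
have oy : overlap p q y := overlap_self cy.
(* The Jacobian has trivial kernel because the differential of the opposite change of coordinates
   undoes it. *)
have uJ : J \in unitmx.
  have dT := transition_differentiable oy.
  have dT' := transition_differentiable (overlap_transition oy).
  rewrite -row_free_unit; apply: inj_row_free => v.
  rewrite /J -(deriveEjacobian v dT) => E.
  by rewrite -(derive_transitionK v oy) E derive0.
by rewrite !unitmx_mul unitmx_tr uJ gram_nondegenerate.
Qed.

(** Links tensors at a point, given in its preferred chart, with the coordinate formulas: the change
    from a chart to itself is the identity. *)
Lemma local_gram_base p : local_gram g p (chart_at p p) = g p.
Proof.
have pp := chart_at_mem p; have cp : chart_cod (chart_at p) (chart_at p p) by exists p.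
have op : overlap p p (chart_at p p) by exists p.
have E u : 'D_u (transition p p) (chart_at p p) = u.
  apply: (etrans _ (derive_id (chart_at p p) u)).
  apply: (eq_on_derive _ (@overlap_open p p) op) => _ [r [rp _] <-].
  by rewrite /transition /= chart_mapK.
apply/matrixP => i j; rewrite -!bil_basis bil_local_gram // chart_mapK //.
by rewrite !E.
Qed.

End Charts.

(** * Isometric immersions read in charts *)

Section IsometricImmersion.
Variables (R : realType) (n m : nat) (M : manifold R n) (N : manifold R m).
Variables (g : metric M) (gN : metric N) (F : M -> N).
Hypothesis immF : isometric_immersion g gN F.

Definition local_dom (p : M) : set 'rV[R]_n :=
  chart_at p @` (chart_dom (chart_at p) `&` F @^-1` chart_dom (chart_at (F p))).

Lemma local_dom_open p (q : N) :
  open (chart_at p @` (chart_dom (chart_at p) `&` F @^-1` chart_dom (chart_at q))).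
Proof.
have [[cF _] _ _] := immF.
apply: chart_image_open; last by move=> r [].
apply: openI; first exact: chart_dom_open.
by apply: open_comp; [move=> *; exact: cF | exact: chart_dom_open].
Qed.

Lemma local_map_smooth p : smooth_on (local_dom p) (local_map F p).
Proof. by have [[_ sF] _ _] := immF; exact: sF. Qed.

Lemma local_map_cod p y : local_dom p y -> chart_cod (chart_at (F p)) (local_map F p y).
Proof.
move=> [q [qp qF] <-]; exists (F q) => //.
by rewrite /local_map /= chart_mapK.
Qed.

Lemma local_dom_cod p : local_dom p `<=` chart_cod (chart_at p).
Proof. by move=> _ [q [qp _] <-]; exists q. Qed.

Lemma local_dom_base p : local_dom p (chart_at p p).
Proof. by exists p => //; split=> /=; exact: chart_at_mem. Qed.

Lemma local_map_base p : local_map F p (chart_at p p) = chart_at (F p) (F p).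
Proof. by rewrite /local_map /= chart_mapK //; exact: chart_at_mem. Qed.

(** The isometry condition at a point [q] uses the preferred charts of [q] and [F q], whereas the
    computation near [p] keeps the charts of [p] and [F p]. The chain rule on the commuting square
    of coordinate changes compares them. *)
Lemma derive_local_map p y u : local_dom p y ->
  let q := chart_inv (chart_at p) y in
  'D_('D_u (local_map F p) y) (transition (F p) (F q)) (local_map F p y) =
  'D_('D_u (transition p q) y) (local_map F q) (chart_at q q).
Proof.
move=> /[dup] Ay [r [rp rF] ry] q.
have qr : q = r by rewrite /q -ry chart_mapK.
have ov : overlap p q y by exists r => //; rewrite qr; split=> //; exact: chart_at_mem.
have fy : local_map F p y = chart_at (F p) (F r) by rewrite /local_map /= -/q qr.
have ovF : overlap (F p) (F q) (local_map F p y).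
  by rewrite fy qr; exists (F r) => //; split=> //; exact: chart_at_mem.
have Ty : transition p q y = chart_at q q by [].
have df := smooth_differentiable (@local_map_smooth p) y Ay.
have dT := transition_differentiable ovF.
have dT' := transition_differentiable ov.
have df' := smooth_differentiable (@local_map_smooth q) _ (@local_dom_base q).
rewrite -Ty in df' *.
have [_ E1] := is_derive_chain u df dT.
have [_ E2] := is_derive_chain u dT' df'.
apply: (etrans (esym E1)); apply: (etrans _ E2).
have oA : open (local_dom p `&` overlap p q).
  by apply: openI; [exact: local_dom_open | exact: overlap_open].
apply: (eq_on_derive u oA) => // _ [[s [sp sF] <-] [s' [s'p s'q] ss']].
have es : s' = s.
  by rewrite -(chart_mapK s'p) ss' chart_mapK.
by rewrite es in s'q; rewrite /transition /local_map /= !chart_mapK.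
Qed.

Lemma local_gram_pullback p y : local_dom p y -> forall u v,
  bil (local_gram g p y) u v =
  bil (local_gram gN (F p) (local_map F p y)) ('D_u (local_map F p) y) ('D_v (local_map F p) y).
Proof.
move=> Ay u v; rewrite (bil_local_gram g _ _ (local_dom_cod Ay)).
rewrite (bil_local_gram gN _ _ (local_map_cod Ay)).
have -> : chart_inv (chart_at (F p)) (local_map F p y) = F (chart_inv (chart_at p) y).
  by case: Ay => r [rp rF] <-; rewrite /local_map /= !chart_mapK.
rewrite !derive_local_map //.
by have [_ _ iso] := immF; rewrite -iso.
Qed.

End IsometricImmersion.

(** * The Gauss equation and Ricci tensor of a hypersurface in a space of constant curvature *)

Section GaussManifold.
Variables (R : realType) (n : nat) (M : manifold R n) (N : manifold R n.+1).
Variables (g : metric M) (gN : metric N) (F : M -> N) (xi : M -> 'rV[R]_n.+1).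
Variables (s : nat) (c eps : R).
Hypothesis immF : isometric_immersion g gN F.
Hypothesis ccN : constant_curvature_space gN s c.
Hypothesis eps2 : eps ^+ 2 = 1.
Hypothesis nxi : unit_normal gN F eps xi.

Let A p := local_dom F p.
Let B p := chart_cod (chart_at (F p)).
Let f p := local_map F p.
Let G p := local_gram g p.
Let GN p := local_gram gN (F p).

Let gram_base p : GN p (f p (chart_at p p)) = gN (F p).
Proof. by rewrite /GN /f local_map_base local_gram_base. Qed.

Lemma second_fundamentalE p :
  second_fundamental gN F xi p = second_form (GN p) (f p) (xi p) (chart_at p p).
Proof.
apply/matrixP => i j; rewrite !mxE.
exact: (congr1 (fun q => bil q (ambient_derivative gN F p _ _) (xi p)) (esym (gram_base p))).
Qed.

Lemma second_fundamentalT p :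
  (second_fundamental gN F xi p)^T = second_fundamental gN F xi p.
Proof.
rewrite second_fundamentalE; apply: (@second_formT _ _ _ (A p) (B p)).
- exact: (local_dom_open immF).
- exact: chart_cod_open.
- exact: gram_smooth.
- by move=> y _; exact: local_gramT.
- exact: local_gram_unit.
- exact (local_map_smooth immF p).
- move=> y Ay; exact (local_map_cod Ay).
- exact (local_dom_base F p).
Qed.

(** [gauss_equation] at the base point of the chart. The ambient curvature of tangent vectors
    becomes [c / 2] times [g ^ g] because [dmap] preserves scalar products. *)
Lemma gauss_constant_curvature p X Y Z W :
  let H := second_fundamental gN F xi p in
  riemann g p X Y Z W = c / 2 * KN (g p) (g p) X Y Z W + eps / 2 * KN H H X Y Z W.
Proof.
move=> H; have [_ injF isoF] := immF.
have xA : A p (chart_at p p) := local_dom_base F p.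
have oA : open (A p) by exact: (local_dom_open immF).
have oB : open (B p) by exact: chart_cod_open.
have sG : smooth_on (A p) (G p).
  exact: smooth_on_sub (@local_dom_cod _ _ _ _ _ F p) (@gram_smooth _ _ _ g p).
have sGN : smooth_on (B p) (GN p) by exact: gram_smooth.
have symG y : A p y -> (G p y)^T = G p y by move=> _; exact: local_gramT.
have symGN y : B p y -> (GN p y)^T = GN p y by move=> _; exact: local_gramT.
have unitG y : A p y -> G p y \in unitmx.
  by move=> Ay; exact (local_gram_unit g (local_dom_cod Ay)).
have unitGN y : B p y -> GN p y \in unitmx by move=> By; exact (local_gram_unit gN By).
have sf : smooth_on (A p) (f p) := local_map_smooth immF p.
have fAB y : A p y -> B p (f p y) by move=> Ay; exact (local_map_cod Ay).
have pull y : A p y -> forall u v, bil (G p y) u v =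
   bil (GN p (f p y)) ('D_u (f p) y) ('D_v (f p) y).
  by move=> Ay u v; exact (local_gram_pullback immF Ay u v).
have nxi' : bil (GN p (f p (chart_at p p))) (xi p) (xi p) = eps.
  by rewrite gram_base; have [] := nxi p.
have txi u : bil (GN p (f p (chart_at p p))) ('D_u (f p) (chart_at p p)) (xi p) = 0.
  by rewrite gram_base; have [_ ->] := nxi p.
have HE u v : bil H u v = bil (GN p (f p (chart_at p p)))
    (ambient (GN p) (f p) u v (chart_at p p)) (xi p).
  rewrite /H second_fundamentalE.
  exact (bil_second_form oA oB sGN symGN unitGN sf fAB (xi p) u v xA).
have ge := gauss_equation oA sG symG unitG oB sGN symGN unitGN sf fAB pull X Y Z W xA
  erefl (@injF p) eps2 nxi' txi.
have ccE : bil (GN p (f p (chart_at p p))) (curvature_at (GN p) (f p (chart_at p p))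
    (dmap F p X) (dmap F p Y) (dmap F p Z)) (dmap F p W) = c / 2 * KN (g p) (g p) X Y Z W.
  have [_ cc] := ccN (F p).
  rewrite gram_base {1}/f local_map_base; apply: (etrans (cc _ _ _ _)).
  by rewrite /KN; move: (dmap F p) (isoF p) => D iso; rewrite !iso.
have hE : bil (GN p (f p (chart_at p p))) (ambient (GN p) (f p) X W (chart_at p p)) (xi p)
    * bil (GN p (f p (chart_at p p))) (ambient (GN p) (f p) Y Z (chart_at p p)) (xi p)
  - bil (GN p (f p (chart_at p p))) (ambient (GN p) (f p) X Z (chart_at p p)) (xi p)
    * bil (GN p (f p (chart_at p p))) (ambient (GN p) (f p) Y W (chart_at p p)) (xi p)
  = bil H X W * bil H Y Z - bil H X Z * bil H Y W.
  by rewrite (HE X W) (HE Y Z) (HE X Z) (HE Y W).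
rewrite /riemann /riemann_op -[X in bil X _ _](local_gram_base g p).
apply: (etrans ge); apply: (etrans (congr2 (fun a b => a + eps * b) ccE hE)).
by rewrite /KN; field.
Qed.

Lemma scalar_curvature_constant q : scalar_curvature gN q = n.+1%:R * n%:R * c.
Proof.
have [_ cc] := ccN q; have gT := gram_sym gN q; have gU := gram_nondegenerate gN q.
(* A vanishing second term brings constant curvature into the shape required by [ricci_gauss]. *)
have cc0 X Y Z W : bil (gN q) (riemann_op gN q X Y Z) W =
    c / 2 * KN (gN q) (gN q) X Y Z W + 0 / 2 * KN (gN q) (gN q) X Y Z W.
  by rewrite !mul0r addr0; exact: cc.
rewrite /scalar_curvature /ricci (ricci_gauss gT gU gT cc0) scale0r add0r tr2Z tr2g //.
by rewrite -[n.+1]addn1 natrD addrK; ring.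
Qed.

Lemma ricci_hypersurface p : let H := second_fundamental gN F xi p in
  ricci g p = eps *: (tr2 (g p) H *: H - square2 (g p) H) + ((n%:R - 1) * c) *: g p.
Proof.
move=> H; apply: (ricci_gauss (gram_sym g p) (gram_nondegenerate g p)).
  exact: second_fundamentalT.
exact: gauss_constant_curvature.
Qed.

End GaussManifold.

Theorem theorem8p1 (R : realType) (n s : nat) (c kt eps : R)
  (M : manifold R n) (g : metric M)
  (N : manifold R n.+1) (gN : metric N)
  (F : M -> N) (xi : M -> 'rV[R]_n.+1)
  (H : M -> 'M[R]_n) (LC psi rho : M -> R) :
  (4 <= n)%N ->
  constant_curvature_space gN s c ->
  (forall q : N, scalar_curvature gN q = kt) ->
  isometric_immersion g gN F ->
  (eps = 1 \/ eps = -1) ->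
  unit_normal gN F eps xi ->
  (forall p : M, H p = second_fundamental gN F xi p) ->
  ~ einstein g ->
  ~ conformally_flat g ->
  (forall p : M, U_H g H p ->
     (forall X1 X2 X3 X4 X Y : 'rV[R]_n,
        dotT (g p) (weyl g p) (weyl g p) X1 X2 X3 X4 X Y
        = LC p * QT (g p) (weyl g p) X1 X2 X3 X4 X Y) /\
     cube2 (g p) (H p)
     = tr2 (g p) (H p) *: square2 (g p) (H p) + psi p *: H p + rho p *: g p) ->
  forall p : M, U_H g H p ->
  forall X1 X2 X3 X4 : 'rV[R]_n,
    ((scalar_curvature g p + 2 * eps * psi p) / (n%:R - 1)
       - kt / (n%:R + 1) - LC p) * weyl g p X1 X2 X3 X4
    = (n%:R - 3) / ((n%:R - 2) ^+ 2 * (n%:R - 1)) * tensor_E g p X1 X2 X3 X4.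
Proof.
move=> n4 ccN ktE immF epsE nxi HE _ _ hyp p Up X1 X2 X3 X4.
have eps2 : eps ^+ 2 = 1 by case: epsE => ->; rewrite ?sqrrN expr1n.
have [CC H3E] := hyp p Up; rewrite HE in H3E.
(* The ambient scalar curvature is [(n + 1) n c], while [contracted_identity] is stated with [c]. *)
have -> : kt / (n%:R + 1) = n%:R * c.
  have n1 : n%:R + 1 != 0 :> R by rewrite natr1 pnatr_eq0.
  by rewrite -(ktE (F p)) (scalar_curvature_constant ccN) -natr1; field.
apply: (contracted_identity (gram_sym g p) (gram_nondegenerate g p)
  (second_fundamentalT xi immF p) eps2 n4 H3E _ (ricci_hypersurface immF ccN eps2 nxi p) erefl CC).
exact: (gauss_constant_curvature immF ccN eps2 nxi).
Qed.
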